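(* For every countably infinite (discrete) group $G$, every nontrivial compact metrizable group $K$, and every subset $H\subseteq G$, the set $H$ is vdC in $G$ if and only if $H$ is measure-theoretic $(K,G)$-vdC.
   Context: A measure-preserving system (m.p.s.) $(X,\mathscr{B},\mu,(T_g)_{g\in G})$ consists of a standard probability space $(X,\mathscr{B},\mu)$ and a measure-preserving action $T$ of $G$ on it. $H$ is vdC in $G$ if: whenever $(X,\mathscr{B},\mu,(T_g)_{g\in G})$ is an m.p.s., $f\colon X\to\mathbb{C}$ is a bounded measurable function, and $\int_X f(T_hx)\overline{f(x)}\,d\mu(x)=0$ for all $h\in H$, then $\int_X f\,d\mu=0$. $K$ is equipped with its Borel $\sigma$-algebra, and $m_K$ denotes its normalized Haar measure. A $K$-valued measurable map $F$ on a probability space $(X,\mathscr{B},\mu)$ is Haar distributed if $F_*\mu=m_K$. $H$ is measure-theoretic $(K,G)$-vdC if: whenever $(X,\mathscr{B},\mu,(T_g)_{g\in G})$ is an m.p.s., $F\colon X\to K$ is a Borel measurable map, and the map $x\mapsto F(T_hx)F(x)^{-1}$ is Haar distributed for every $h\in H$, then $F$ itself is Haar distributed. *)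

(* Defs.v *)
From HB Require Import structures.
From mathcomp Require Import all_boot all_order all_algebra.
From mathcomp Require Import complex.
From mathcomp Require Import all_classical all_reals all_analysis.

Set Implicit Arguments.
Unset Strict Implicit.
Unset Printing Implicit Defensive.

Import Order.TTheory GRing.Theory Num.Theory.
Import numFieldNormedType.Exports.

Local Open Scope classical_set_scope.
Local Open Scope ring_scope.

(* The base point carries no content: measurable types are pointed in
   MathComp-Analysis, and K is to carry its Borel sigma-algebra. *)
HB.mixin Record PointedTopological_isTopologicalGroup K
    & PointedTopological K & Group K := {
  mulg_continuous : continuous (fun x : K * K => (x.1 * x.2)%g) ;
  invg_continuous : continuous (fun x : K => (x^-1)%g) ;
}.

#[short(type="topologicalGroupType")]
HB.structure Definition TopologicalGroup :=
  {K of PointedTopological K & Group K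
      & PointedTopological_isTopologicalGroup K}.

#[short(type="completeMetricType")]
HB.structure Definition CompleteMetric (R : numDomainType) :=
  {M of Metric R M & Complete M}.

Notation borel T := (g_sigma_algebraType (open : set (set T))).

Definition metrizable (R : realType) (T : topologicalType) : Prop :=
  exists (M : metricType R) (phi : T -> M),
    bijective phi /\ forall U : set T, open U <-> open (phi @` U).

(* A standard probability space is a probability on a standard Borel space:
   the sigma-algebra is the Borel one of a complete separable metric. *)
Definition standard_borel (R : realType) d (X : measurableType d) : Prop :=
  exists (M : completeMetricType R) (phi : X -> M),
    [/\ @second_countable M, bijective phi &
      forall A : set X, measurable A <-> <<s @open M >> (phi @` A)].

Record is_mps (R : realType) (G : groupType) d (X : measurableType d)
    (mu : probability X R) (T : G -> X -> X) : Prop := IsMps {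
  mps_standard : standard_borel R X ;
  mps_act1 : forall x, T 1%g x = x ;
  mps_actM : forall g h x, T (g * h)%g x = T g (T h x) ;
  mps_measurable : forall g, measurable_fun setT (T g) ;
  mps_preserving : forall g (A : set X),
    measurable A -> mu (T g @^-1` A) = mu A
}.

(* m_K : the left-invariant Borel probability measure of K. *)
Definition normalized_haar (R : realType) (K : topologicalGroupType)
    (m : probability (borel K) R) : Prop :=
  forall (g : K) (A : set (borel K)), measurable A ->
    m [set (g * x)%g | x in A] = m A.

(* F_* mu = m_K.  The quantifier only names m_K: a compact group has exactly
   one normalized Haar measure. *)
Definition haar_distributed (R : realType) (K : topologicalGroupType)
    d (X : measurableType d) (mu : probability X R) (F : X -> K) : Prop :=
  exists2 mK : probability (borel K) R, normalized_haar mK &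
    forall A : set (borel K), measurable A ->
      pushforward mu (F : X -> borel K) A = mK A.

Definition mt_vdC (R : realType) (K : topologicalGroupType) (G : groupType)
    (H : set G) : Prop :=
  forall d (X : measurableType d) (mu : probability X R) (T : G -> X -> X),
    is_mps mu T ->
  forall F : X -> K,
    measurable_fun setT (F : X -> borel K) ->
    (forall h, H h -> haar_distributed mu (fun x => F (T h x) * (F x)^-1)%g) ->
  haar_distributed mu F.

Definition Cintegral (R : realType) d (X : measurableType d)
    (mu : probability X R) (f : X -> R[i]) : R[i] :=
  Complex (\int[mu]_x complex.Re (f x)) (\int[mu]_x complex.Im (f x)).

(* borel R[i]^o is for the topology of the norm `|z| = sqrt (Re z ^ 2 + Im z ^ 2). *)
Definition vdC (R : realType) (G : groupType) (H : set G) : Prop :=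
  forall d (X : measurableType d) (mu : probability X R) (T : G -> X -> X),
    is_mps mu T ->
  forall f : X -> R[i],
    measurable_fun setT (f : X -> borel R[i]^o) ->
    (exists C : R, forall x, `|f x| <= C%:C%C) ->
    (forall h, H h -> Cintegral mu (fun x => f (T h x) * (f x)^*%C) = 0) ->
  Cintegral mu f = 0.

(* Main.v *)
(** Suppose that H is vdC and that F is as in the definition of a measure-theoretic
vdC set. Let K carry its Haar measure m and a trivial action. For a measurable
subset A of K and a function c on K with values 1 and -1, the function
c(k) (1_A(F(x) k) - m(A)) on X * K has vanishing correlations along H: substituting
F(x)^-1 k for k turns F(T_h x) k into (F(T_h x) F(x)^-1) k, whose first factor is
Haar distributed. So these functions have mean 0, i.e., k and F(x) k are
independent and Haar distributed, and F(x) = (F(x) k) k^-1 is Haar distributed.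

Conversely, suppose that 1 is not in H (otherwise H is vdC), and let f be a bounded
function with vanishing correlations along H. Weighting the real and imaginary
parts of f on two complementary subsets of K, with a trivial action on K, makes f
real, with values in [-1, 1]. It is then rounded to a sign at random, with
conditional mean f(x) and independently along the orbit; this preserves the
correlations between distinct points of an orbit. Finally F chooses between two
independent Haar distributed elements of K according to that sign, with opposite
biases for the two signs: then F(T_h x) F(x)^-1 is Haar distributed for h in H, but
F is Haar distributed only if the sign, hence f, has mean 0. The randomness is
provided by the Haar measure of powers of K, which makes the coordinates independent
and, by uniqueness, is invariant under the shift action of G. *)

Require Import Defs.
From HB Require Import structures.
From mathcomp Require Import all_boot all_order all_algebra.
From mathcomp Require Import complex.
From mathcomp Require Import all_classical all_reals all_analysis.
From mathcomp Require Import measurable_realfun.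
From mathcomp Require Import ring lra.

Set Implicit Arguments.
Unset Strict Implicit.
Unset Printing Implicit Defensive.

Import Order.TTheory GRing.Theory Num.Theory.
Import numFieldNormedType.Exports.

Local Open Scope classical_set_scope.
Local Open Scope ring_scope.

(** * Haar measure of a compact Hausdorff group *)

(* The proof argument lets the probability structure be inferred. *)
Definition total_mass1 (R : realType) d (T : measurableType d)
    (m : {measure set T -> \bar R}) (_ : m setT = 1%E) : set T -> \bar R := m.

HB.instance Definition _ (R : realType) d (T : measurableType d)
  (m : {measure set T -> \bar R}) (h : m setT = 1%E) := Measure.on (total_mass1 h).

HB.instance Definition _ (R : realType) d (T : measurableType d)
    (m : {measure set T -> \bar R}) (h : m setT = 1%E) :=
  Measure_isProbability.Build _ _ _ (total_mass1 h) h.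

(** * From a content on closed sets to a Borel probability measure *)

Section measure_of_content.
Context (R : realType) (K : ptopologicalType) (lam : set K -> R).

(** Halmos's scheme: a content [lam] on compact sets, which in a compact Hausdorff space are the
    closed ones, yields an inner content on open sets, and this yields an outer measure for which
    open sets are measurable. *)
Definition inner_content (U : set K) : \bar R :=
  ereal_sup [set (lam C)%:E | C in [set C | closed C /\ C `<=` U]].

Definition outer_content (A : set K) : \bar R :=
  ereal_inf [set inner_content U | U in [set U | open U /\ A `<=` U]].

Context (cK : compact [set: K]) (hK : hausdorff_space K).
Context (lam0 : lam set0 = 0) (lamT : lam setT = 1).
Context (lam_le : forall C D, C `<=` D -> lam C <= lam D).
Context (lamU : forall C D, lam (C `|` D) <= lam C + lam D).
Context (lamD : forall C D, closed C -> closed D -> C `&` D = set0 ->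
  lam C + lam D <= lam (C `|` D)).

Local Open Scope ereal_scope.

Let inner_lub C U : closed C -> C `<=` U -> (lam C)%:E <= inner_content U.
Proof. by move=> cC CU; apply: ereal_sup_ubound; exists C. Qed.

Let inner_ge0 U : 0 <= inner_content U.
Proof. by have := inner_lub closed0 (@sub0set _ U); rewrite lam0. Qed.

Let inner_le1 U : inner_content U <= 1.
Proof.
apply: ge_ereal_sup => _ [C [cC CU] <-]; rewrite lee_fin -lamT.
exact: lam_le.
Qed.

Let inner_le U V : U `<=` V -> inner_content U <= inner_content V.
Proof.
move=> UV; apply: ge_ereal_sup => _ [C [cC CU] <-]; apply: inner_lub => //.
exact: subset_trans UV.
Qed.

Let inner0 : inner_content set0 = 0.
Proof.
apply/le_anti; rewrite inner_ge0 andbT.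
by apply: ge_ereal_sup => _ [C [cC +] <-]; rewrite subset0 => ->; rewrite lam0.
Qed.

(* By normality, a closed set contained in the union of U and V is the union of
   a closed subset of U and a closed subset of V. *)
Let innerU2 U V : open U -> open V ->
  inner_content (U `|` V) <= inner_content U + inner_content V.
Proof.
move=> oU oV; apply: ge_ereal_sup => _ [C [cC CUV] <-].
have cA : closed (C `&` ~` V) by apply: closedI => //; exact: open_closedC.
have AU : C `&` ~` V `<=` U by move=> x [/CUV[]].
have [D Dnbhs clD] : filter_from (set_nbhs (C `&` ~` V)) closure U.
  have := compact_normal hK cK cA; move=> /(_ U); apply.
  by apply/set_nbhsP; exists U; split.
have CE : C = (C `&` closure D) `|` (C `&` ~` D°).
  rewrite -setIUr; apply/esym/setIidPl => x _.
  have [Dx|] := pselect (D° x); last by right.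
  by left; apply: subset_closure; exact: interior_subset Dx.
rewrite CE (le_trans (_ : _ <= (lam (C `&` closure D) + lam (C `&` ~` D°))%:E))//.
  by rewrite lee_fin lamU.
rewrite EFinD leeD// inner_lub//.
- by apply: closedI => //; exact: closed_closure.
- by move=> x [_] /clD.
- by apply: closedI => //; apply: open_closedC; exact: open_interior.
- move=> x [Cx nDx]; apply: contrapT => Vx; apply: nDx.
  exact: Dnbhs.
Qed.

Let inner_bigsetU (U : (set K)^nat) n : (forall i, open (U i)) ->
  inner_content (\big[setU/set0]_(i < n) U i) <= \sum_(i < n) inner_content (U i).
Proof.
move=> oU; elim: n => [|n IH]; first by rewrite !big_ord0 inner0.
rewrite !big_ord_recr /= (le_trans (innerU2 _ _))//; last by rewrite leeD2r.
by rewrite -bigcup_mkord; apply: bigcup_open => i _.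
Qed.

(** A closed subset of the union is compact, so finitely many of the [U i] cover it and finite
    subadditivity applies. *)
Let inner_sigma (U : (set K)^nat) : (forall i, open (U i)) ->
  inner_content (\bigcup_i U i) <= \sum_(i <oo) inner_content (U i).
Proof.
move=> oU; apply: ge_ereal_sup => _ [C [cC CU] <-].
have := subclosed_compact cC cK (@subsetT _ C).
rewrite compact_cover => /(_ nat setT U (fun i _ => oU i) CU) [D _ CD].
pose N := (\max_(i <- finmap.enum_fset D) i).+1.
have CN : C `<=` \big[setU/set0]_(i < N) U i.
  apply: (subset_trans CD); rewrite -bigcup_mkord => x [i /= iD Ux].
  by exists i => //=; rewrite ltnS; exact: leq_bigmax_seq.
rewrite (le_trans (inner_lub cC CN))// (le_trans (inner_bigsetU _ oU))//.
rewrite -(big_mkord xpredT (inner_content \o U)).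
by apply: nneseries_lim_ge => n _ _; exact: inner_ge0.
Qed.

Let outer_glb A U : open U -> A `<=` U -> outer_content A <= inner_content U.
Proof. by move=> oU AU; apply: ereal_inf_lbound; exists U. Qed.

Let outer_ge0 A : 0 <= outer_content A.
Proof. by apply: le_ereal_inf_tmp => _ [U _ <-]. Qed.

Let outer_fin A : outer_content A \is a fin_num.
Proof.
rewrite ge0_fin_numE// (le_lt_trans (outer_glb openT (@subsetT _ A)))//.
by rewrite (le_lt_trans (inner_le1 _))// ltry.
Qed.

Let outer_le : {homo outer_content : A B / A `<=` B >-> A <= B}.
Proof.
move=> A B AB; apply: le_ereal_inf_tmp => _ [U [oU BU] <-].
by apply: outer_glb => //; exact: subset_trans BU.
Qed.

Let outer0 : outer_content set0 = 0.
Proof.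
apply/le_anti; rewrite outer_ge0 andbT -inner0.
by apply: outer_glb => //; exact: open0.
Qed.

Let outer_open U : open U -> outer_content U = inner_content U.
Proof.
move=> oU; apply/le_anti; rewrite outer_glb//=.
by apply: le_ereal_inf_tmp => _ [V [oV UV] <-]; exact: inner_le.
Qed.

Let outer_sigma : sigma_subadditive outer_content.
Proof.
move=> A; apply/lee_addgt0Pr => e e0.
have [U UP] : {U : (set K)^nat & forall n, [/\ open (U n), A n `<=` U n &
    inner_content (U n) <= outer_content (A n) + (e / (2 ^ n.+1)%:R)%:E]}.
  apply: (@choice _ _ (fun n U => [/\ open U, A n `<=` U &
    inner_content U <= outer_content (A n) + (e / (2 ^ n.+1)%:R)%:E])) => n.
  have en : (0 < e / (2 ^ n.+1)%:R)%R by rewrite divr_gt0// ltr0n expn_gt0.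
  have /(lb_ereal_inf_adherent en) := outer_fin (A n).
  by move=> [_ [U [oU AU] <-] /ltW Ue]; exists U.
rewrite (le_trans _ (epsilon_trick _ _ (ltW e0)))//.
rewrite (le_trans (_ : _ <= inner_content (\bigcup_n U n)))//.
  apply: outer_glb; first by apply: bigcup_open => i _; have [] := UP i.
  by apply: subset_bigcup => i _; have [] := UP i.
rewrite (le_trans (inner_sigma _))//; first by move=> i; have [] := UP i.
by apply: lee_nneseries => // n _; have [] := UP n.
Qed.

Let mu : {outer_measure set K -> \bar R} := HB.pack_for (outer_measure R K)
  outer_content (isOuterMeasure.Build R K outer_content outer0 outer_ge0 outer_le
    outer_sigma).

(** Inside an open [V] containing the test set, approximate the intersection of [V] and [U] by a
    closed [C], then the open set [V] minus [C], which contains [V] minus [U], by a closed [D]. As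
    [C] and [D] are disjoint, [lamD] bounds the sum of their contents by the inner content of
    [V]. *)
Let open_caratheodory U : open U -> mu.-caratheodory U.
Proof.
move=> oU; apply: le_caratheodory_measurable => X.
apply: le_ereal_inf_tmp => _ [V [oV XV] <-].
rewrite (@le_trans _ _ (outer_content (V `&` U) + outer_content (V `&` ~` U)))//.
  by rewrite leeD// outer_le//; exact: setSI.
rewrite outer_open; last exact: openI.
rewrite -leeBrDr//; apply: ge_ereal_sup => _ [C [cC CVU] <-].
rewrite leeBrDr// addeC -leeBrDr//.
rewrite (@le_trans _ _ (inner_content (V `&` ~` C)))//.
  apply: outer_glb; first by apply: openI => //; exact: closed_openC.
  by apply: setIS; apply: subsetC => x /CVU[].
apply: ge_ereal_sup => _ [D [cD DVC] <-].
rewrite leeBrDr// addeC -EFinD.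
rewrite (@le_trans _ _ (lam (C `|` D))%:E)//.
  rewrite lee_fin lamD//; apply/disjoints_subset.
  by move=> x Cx /DVC[].
apply: inner_lub; first exact: closedU.
by rewrite subUset; split=> [x /CVU[]|x /DVC[]].
Qed.

Let borel_caratheodory (A : set (borel K)) : measurable A -> mu.-caratheodory A.
Proof.
apply: smallest_sub; last exact: open_caratheodory.
exact: (sigma_algebra_measurable (caratheodory_type mu)).
Qed.

Let outer_semi_sigma_additive :
  semi_sigma_additive (outer_content : set (borel K) -> \bar R).
Proof.
move=> F mF tF mUF.
by apply: (@caratheodory_measure_sigma_additive R K mu) => // [i|];
  exact: borel_caratheodory.
Qed.

Let outerT : outer_content setT = 1.
Proof.
rewrite outer_open; last exact: openT.
apply/le_anti; rewrite inner_le1/= -lamT.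
by apply: inner_lub => //; exact: closedT.
Qed.

Lemma measure_of_content : exists mu : probability (borel K) R,
  forall A : set (borel K), measurable A -> mu A = outer_content A.
Proof.
have [m0 m0E] : exists m0 : {measure set (borel K) -> \bar R},
    m0 = outer_content :> (set (borel K) -> \bar R).
  pose m0 : {measure set (borel K) -> \bar R} := HB.pack_for (measure (borel K) R)
  (outer_content : set (borel K) -> \bar R) (isMeasure.Build _ (borel K) R
  (outer_content : set (borel K) -> \bar R) outer0 outer_ge0 outer_semi_sigma_additive).
  by exists m0.
have m1 : m0 setT = 1 by rewrite m0E.
by exists (total_mass1 m1 : probability _ _) => A _; rewrite -m0E.
Qed.

End measure_of_content.

Local Notation lmul g := (fun x => g * x)%g.

Lemma open_borel (T : ptopologicalType) (U : set T) :
  open U -> measurable (U : set (borel T)).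
Proof. exact: sub_sigma_algebra. Qed.

Lemma measurable_fun_borel d (X : measurableType d) (T : ptopologicalType)
    (f : X -> T) :
  (forall U, open U -> measurable (f @^-1` U)) ->
  measurable_fun setT (f : X -> borel T).
Proof.
move=> fo; apply: (@measurability _ _ X (borel T) setT f (@open T)) => //.
by move=> _ [U oU <-]; rewrite setTI; exact: fo.
Qed.

Lemma continuous_borel (T U : ptopologicalType) (f : T -> U) :
  continuous f -> measurable_fun setT (f : borel T -> borel U).
Proof.
move=> /continuousP cf; apply: measurable_fun_borel => V oV.
by apply: open_borel; exact: cf.
Qed.

Section topological_group.
Context (K : topologicalGroupType).

Lemma cvg_mulg T (F : set_system T) (FF : Filter F) (f g : T -> K) a b :
  f @ F --> a -> g @ F --> b -> (fun x => f x * g x)%g @ F --> (a * b)%g.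
Proof.
apply: (@continuous2_cvg _ _ _ _ F FF f g (fun x y => x * y)%g).
exact: (@mulg_continuous K (a, b)).
Qed.

Lemma cvg_invg T (F : set_system T) (FF : Filter F) (f : T -> K) a :
  f @ F --> a -> (fun x => (f x)^-1)%g @ F --> (a^-1)%g.
Proof. by move=> fa; apply: continuous_cvg fa; exact: invg_continuous. Qed.

Lemma lmulg_continuous (g : K) : continuous (lmul g).
Proof. by move=> x; apply: cvg_mulg; [exact: cvg_cst|exact: cvg_id]. Qed.

Lemma rmulg_continuous (g : K) : continuous (fun x : K => x * g)%g.
Proof. by move=> x; apply: cvg_mulg; [exact: cvg_id|exact: cvg_cst]. Qed.

Lemma translateE (g : K) (A : set K) :
  [set (g * x)%g | x in A] = lmul (g^-1)%g @^-1` A.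
Proof.
apply/seteqP; split=> [_ [x Ax <-]|x /= Ax]; first by rewrite /= mulKg.
by exists (g^-1 * x)%g => //; rewrite mulVKg.
Qed.

End topological_group.

(** * Covering numbers by translates of a neighbourhood of 1 *)

Section covering_number.
Context (K : topologicalGroupType) (cK : compact [set: K]).
Implicit Types (U A B : set K) (g x : K) (s : seq K).

Definition covered_by U s : set K := [set x | exists2 g, g \in s & U (g^-1 * x)%g].

Definition covers U A n := exists2 s : seq K, size s = n & A `<=` covered_by U s.

Lemma covers_ex U A : nbhs 1%g U -> exists n, `[< covers U A n >].
Proof.
move=> U1.
have : finite_subset_cover [set: K] (fun g => lmul (g^-1)%g @^-1` U°) [set: K].
  move: cK; rewrite compact_cover; apply.
    move=> g _; apply: open_comp; last exact: open_interior.
    by move=> x _; exact: lmulg_continuous.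
  by move=> x _; exists x => //; rewrite /preimage/= mulVg.
move=> [D _ DK]; exists (size (finmap.enum_fset D)); apply/asboolP.
exists (finmap.enum_fset D) => // x _.
by have [g gD /interior_subset Ux] := DK x I; exists g.
Qed.

(* Junk value 0 when A has no finite cover, which never happens if U is a
   neighbourhood of 1. *)
Definition covnum U A : nat :=
  if pselect (exists n, `[< covers U A n >]) is left h then ex_minn h else 0%N.

Lemma covnum_covers U A : nbhs 1%g U -> covers U A (covnum U A).
Proof.
move=> U1; rewrite /covnum; case: pselect => [h|/(_ (covers_ex A U1))//].
by case: ex_minnP => m /asboolP.
Qed.

Lemma covnum_le U A n : covers U A n -> (covnum U A <= n)%N.
Proof.
move=> An; rewrite /covnum; case: pselect => // h.
by case: ex_minnP => m _; apply; exact/asboolP.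
Qed.

Lemma covnumS U A B : nbhs 1%g U -> A `<=` B -> (covnum U A <= covnum U B)%N.
Proof.
move=> U1 AB; have [s <- Bs] := covnum_covers B U1.
by apply: covnum_le; exists s => //; exact: subset_trans Bs.
Qed.

Lemma covnumU U A B : nbhs 1%g U -> (covnum U (A `|` B) <= covnum U A + covnum U B)%N.
Proof.
move=> U1; have [s <- As] := covnum_covers A U1; have [t <- Bt] := covnum_covers B U1.
apply: covnum_le; exists (s ++ t); first by rewrite size_cat.
by move=> x [/As|/Bt] [g gs Ux]; exists g => //; rewrite mem_cat gs ?orbT.
Qed.

Lemma covnum0 U : covnum U set0 = 0%N.
Proof. by apply/eqP; rewrite -leqn0; apply: covnum_le; exists [::]. Qed.

Lemma covnum_gt0 U : nbhs 1%g U -> (0 < covnum U [set: K])%N.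
Proof.
move=> U1; have [s <- Ks] := covnum_covers [set: K] U1.
by have [g] := Ks 1%g I; case: s {Ks}.
Qed.

Let covnum_translate_le U A g : nbhs 1%g U -> (covnum U (lmul g @^-1` A) <= covnum U A)%N.
Proof.
move=> U1; have [s <- As] := covnum_covers A U1.
apply: covnum_le; exists [seq (g^-1 * h)%g | h <- s]; first by rewrite size_map.
move=> x /= /As [h hs Ux]; exists (g^-1 * h)%g; first exact: map_f.
by rewrite invgM invgK -mulgA.
Qed.

Lemma covnum_translate U A g : nbhs 1%g U -> covnum U (lmul g @^-1` A) = covnum U A.
Proof.
move=> U1; apply/eqP; rewrite eqn_leq covnum_translate_le//=.
rewrite -[leqLHS](_ : covnum U (lmul (g^-1)%g @^-1` (lmul g @^-1` A)) = _).
  exact: covnum_translate_le.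
by congr covnum; rewrite -comp_preimage; apply/seteqP; split => x /=; rewrite mulVKg.
Qed.

(** No translate of [U] meets both sets, so in an optimal cover of the union the translates that
    meet [A] and those that meet [B] are different ones, and each family covers its set. *)
Lemma covnum_separated U A B : nbhs 1%g U ->
  (forall g u v, U u -> U v -> A (g * u)%g -> B (g * v)%g -> False) ->
  (covnum U A + covnum U B <= covnum U (A `|` B))%N.
Proof.
move=> U1 sep; have [s <- ABs] := covnum_covers (A `|` B) U1.
pose meets C g := `[< exists2 u, U u & C (g * u)%g >].
have coveredF C : C `<=` A `|` B -> (covnum U C <= count (meets C) s)%N.
  move=> CAB; rewrite -size_filter; apply: covnum_le.
  exists [seq x <- s | meets C x] => //.
  move=> x Cx; have [g gs Ux] := ABs x (CAB x Cx); exists g => //.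
  rewrite mem_filter gs andbT; apply/asboolP.
  by exists (g^-1 * x)%g => //; rewrite mulVKg.
apply: leq_trans
  (leq_add (coveredF A (@subsetUl _ A B)) (coveredF B (@subsetUr _ A B))) _.
rewrite -count_predUI (@eq_count _ (predI _ _) pred0) ?count_pred0 ?addn0 ?count_size//.
move=> g /=; apply/negP => /andP[/asboolP[u Uu Au] /asboolP[v Uv Bv]].
exact: sep Uu Uv Au Bv.
Qed.

End covering_number.

(** The image filter is again an ultrafilter, and it contains a compact segment. *)
Lemma ultra_cvg_bounded (R : realType) T (F : set_system T) (f : T -> R) (a b : R) :
  UltraFilter F -> (\forall x \near F, a <= f x <= b) -> cvg (f @ F).
Proof.
move=> FU fab.
have fU : UltraFilter (f @ F).
  split=> [|G PG FG]; first exact: fmap_proper_filter.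
  apply/seteqP; split => // A GA; have [//|nFA] := in_ultra_setVsetC (f @^-1` A) FU.
  have : G (A `&` ~` A) by apply: filterI => //; exact: FG.
  by rewrite setICr => /filter_ex [].
have := @segment_compact R a b; rewrite compact_ultra => /(_ (f @ F) fU).
case; last by move=> l [_ /= fl]; apply/cvg_ex; exists l.
by apply: filterS fab => x; rewrite /= in_itv.
Qed.

Lemma ler_lim_filter (R : realType) T (F : set_system T) (FF : ProperFilter F)
    (f g : T -> R) (l l' : R) :
  f @ F --> l -> g @ F --> l' -> (\forall x \near F, f x <= g x) -> l <= l'.
Proof.
move=> fl gl fg; rewrite -subr_ge0.
apply: (cvgr_to_ge (cvgB gl fl)); apply: filterS fg => x.
by rewrite -subr_ge0.
Qed.

Section haar_content.
Context (R : realType) (K : topologicalGroupType).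
Context (cK : compact [set: K]) (hK : hausdorff_space K).

Let normalized U A : R := (covnum U A)%:R / (covnum U [set: K])%:R.

(* The limit, along an ultrafilter of neighbourhoods U of 1 shrinking to 1, of the
   relative covering numbers by translates of U. *)
Lemma haar_content : exists lam : set K -> R,
  [/\ lam set0 = 0, lam setT = 1, (forall C D, C `<=` D -> lam C <= lam D),
      (forall C D, lam (C `|` D) <= lam C + lam D) &
      (forall C D, closed C -> closed D -> C `&` D = set0 ->
        lam C + lam D <= lam (C `|` D)) /\
      forall g A, lam (lmul g @^-1` A) = lam A].
Proof.
have [F [FU sF]] := ultraFilterLemma (@powerset_filter_from_filter _ (nbhs (1%g : K)) _).
have PF : ProperFilter F by exact: ultra_proper.
have nF : \forall U \near F, nbhs (1%g : K) U by apply: sF; exact: near_small_set.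
have den U : nbhs 1%g U -> 0 < (covnum U [set: K])%:R :> R.
  by move=> U1; rewrite ltr0n covnum_gt0.
have lam_cvg A : cvg (normalized U A @[U --> F]).
  apply: (@ultra_cvg_bounded _ _ _ _ 0 1); near=> U.
  have U1 : nbhs 1%g U by near: U.
  rewrite divr_ge0//= ler_pdivrMr ?den// mul1r ler_nat.
  exact: covnumS.
exists (fun A => lim (normalized U A @[U --> F])); split.
- by apply: lim_near_cst => //; apply: nearW => U; rewrite /normalized covnum0 mul0r.
- apply: lim_near_cst => //; near=> U; rewrite /normalized divff// gt_eqF// den//.
  by near: U.
- move=> C D CD; apply: ler_lim_filter (lam_cvg C) (lam_cvg D) _; near=> U.
  have U1 : nbhs 1%g U by near: U.
  by rewrite ler_pM2r ?invr_gt0 ?den// ler_nat covnumS.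
- move=> C D.
  apply: ler_lim_filter (lam_cvg _) (cvgD (lam_cvg _) (lam_cvg _)) _; near=> U.
  have U1 : nbhs 1%g U by near: U.
  by rewrite fctE /normalized -mulrDl ler_pM2r ?invr_gt0 ?den// -natrD ler_nat covnumU.
split.
- move=> C D cC cD CD0.
  apply: ler_lim_filter (cvgD (lam_cvg _) (lam_cvg _)) (lam_cvg _) _.
  (* [P] is the set of all c^-1 d with c in [C] and d in [D]: it is compact, and it misses 1 because
     [C] and [D] are disjoint. By continuity of [q] at (1, 1), u^-1 v avoids [P] for u, v in a small
     [U], so no translate of [U] meets both [C] and [D]. *)
  pose q (z : K * K) := (z.1^-1 * z.2)%g.
  have qc : continuous q.
    by move=> z; apply: cvg_mulg; [apply: cvg_invg; exact: cvg_fst|exact: cvg_snd].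
  pose P := q @` (C `*` D).
  have cP : closed P.
    apply: compact_closed => //; apply: continuous_compact.
      exact: continuous_subspaceT.
    by apply: compact_setX; exact: subclosed_compact cK _.
  have nP : ~ P 1%g.
    move=> [[c d] [/= Cc Dd]]; rewrite /q/= => cd1.
    have : (C `&` D) c by split => //; rewrite -(mulg1 c) -cd1 mulVKg.
    by rewrite CD0.
  have : nbhs ((1, 1)%g : K * K) (q @^-1` ~` P).
    apply: qc; apply: open_nbhs_nbhs; split; first exact: closed_openC.
    by rewrite /q/= invg1 mulg1.
  move=> [[V W] /= [V1 W1] VW].
  have small : \forall U \near F, U `<=` V `&` W.
    by apply: sF; apply: small_set_sub; exact: filterI.
  near=> U; have U1 : nbhs 1%g U by near: U.
  have UVW : U `<=` V `&` W by near: U.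
  rewrite fctE /normalized -mulrDl ler_pM2r ?invr_gt0 ?den// -natrD ler_nat.
  rewrite covnum_separated//.
  move=> g u v /UVW[Vu _] /UVW[_ Wv] Cgu Dgv; apply: (VW (u, v)) => //.
  exists (g * u, g * v)%g => //; rewrite /q /=.
  by rewrite invgM -mulgA mulKg.
- move=> g A; apply: cvg_lim => //; apply: cvg_trans (lam_cvg A).
  apply: near_eq_cvg; near=> U; rewrite /normalized covnum_translate//.
  by near: U.
Unshelve. all: by end_near. Qed.

End haar_content.

(** Translations are homeomorphisms, so the invariance of the content passes, as an inequality, to
    the inner content and to the outer measure; the inverse translation gives the reverse
    inequality. *)
Lemma normalized_haar_ex (R : realType) (K : topologicalGroupType) :
  compact [set: K] -> hausdorff_space K ->
  exists m : probability (borel K) R, normalized_haar m.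
Proof.
move=> cK hK; have [lam [lam0 lamT lamS lamU [lamD lamM]]] := haar_content R cK hK.
have [m mE] := measure_of_content cK hK lam0 lamT lamS lamU lamD.
have preim_open (g : K) U : open U -> open (lmul g @^-1` U).
  by move=> oU; apply: open_comp => // x _; exact: lmulg_continuous.
have preim_closed (g : K) C : closed C -> closed (lmul g @^-1` C).
  by move: C; apply/continuous_closedP; exact: lmulg_continuous.
have preimK (g : K) (A : set K) : lmul (g^-1)%g @^-1` (lmul g @^-1` A) = A.
  by rewrite -comp_preimage; apply/seteqP; split => x /=; rewrite mulVKg.
have inner_le (g : K) U : (inner_content lam (lmul g @^-1` U) <= inner_content lam U)%E.
  apply: ge_ereal_sup => _ [C [cC CU] <-]; apply: ereal_sup_ubound.
  exists (lmul (g^-1)%g @^-1` C); last by rewrite lamM.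
  split; first exact: preim_closed.
  by move=> x /CU /=; rewrite mulVKg.
have outer_le (g : K) A : (outer_content lam (lmul g @^-1` A) <= outer_content lam A)%E.
  apply: le_ereal_inf_tmp => _ [U [oU AU] <-]; apply: le_trans (inner_le g U).
  by apply: ereal_inf_lbound; exists (lmul g @^-1` U) => //; split;
    [exact: preim_open|move=> x /AU].
exists m => g A mA; rewrite translateE mE; last first.
  have mg : measurable_fun setT (lmul (g^-1)%g : borel K -> borel K).
    by apply: continuous_borel; exact: lmulg_continuous.
  by rewrite -[X in measurable X]setTI; exact: mg.
rewrite mE//; apply/le_anti; rewrite outer_le/=.
have := outer_le g (lmul (g^-1)%g @^-1` A).
by rewrite -{1}(invgK g) preimK.
Qed.

(** * Standard Borel products *)

Section capped_dist.
Context (R : realType) (T : pseudoMetricType R).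
Implicit Types x y z : T.

Let radii x y : set R := [set e | 0 < e /\ ball x e y] `|` [set 1].

(* The cap 1 is there because points may share no ball. *)
Definition capped_dist x y : R := inf (radii x y).

Let radii0 x y : radii x y !=set0.
Proof. by exists 1; right. Qed.

Let radii_lb x y : has_lbound (radii x y).
Proof. by exists 0 => e [[/ltW]|->]. Qed.

Let capped_dist_ge0 x y : 0 <= capped_dist x y.
Proof. by apply: lb_le_inf => // e [[/ltW]|->]. Qed.

Lemma ball_capped_dist x y e : 0 < e -> ball x e y -> capped_dist x y <= e.
Proof. by move=> e0 xy; apply: ge_inf => //; left. Qed.

Let capped_dist_le1 x y : capped_dist x y <= 1.
Proof. by apply: ge_inf => //; right. Qed.

Lemma capped_dist_ball x y e : e <= 1 -> capped_dist x y < e -> ball x e y.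
Proof.
move=> e1 /(inf_lt (radii0 x y)) [r [[r0 xry] re|-> /lt_le_trans/(_ e1)]].
  exact: le_ball (ltW re) _ xry.
by rewrite ltxx.
Qed.

Lemma capped_distxx x : capped_dist x x = 0.
Proof.
apply/le_anti; rewrite capped_dist_ge0 andbT; apply/ler_addgt0Pr => e e0.
by rewrite add0r; apply: ball_capped_dist => //; exact: ballxx.
Qed.

Lemma capped_dist_sym x y : capped_dist x y = capped_dist y x.
Proof.
rewrite /capped_dist; congr inf; apply/seteqP; split => e [[e0 /ball_sym]|->];
  by [left|right].
Qed.

Lemma capped_dist_triangle y x z :
  capped_dist x z <= capped_dist x y + capped_dist y z.
Proof.
rewrite -lerBlDr; apply: lb_le_inf => // e1 xye1.
rewrite lerBlDr -lerBlDl; apply: lb_le_inf => // e2 yze2.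
rewrite lerBlDl; case: xye1 => [[e10 xy]|->].
  case: yze2 => [[e20 yz]|->].
    by apply: ball_capped_dist; [rewrite addr_gt0|exact: ball_triangle yz].
  by rewrite (le_trans (capped_dist_le1 _ _))// lerDr ltW.
rewrite (le_trans (capped_dist_le1 _ _))// lerDl.
by case: yze2 => [[/ltW]|->].
Qed.

Lemma capped_dist_eq0 : hausdorff_space T ->
  forall x y, capped_dist x y = 0 -> x = y.
Proof.
move=> hT x y xy0; apply: hT => A B /nbhs_ballP[e /= e0 eA] By.
exists y; split; last exact: nbhs_singleton.
apply: eA; have m0 : 0 < Num.min e 1 by rewrite lt_min e0 ltr01.
apply: (@le_ball _ _ _ (Num.min e 1)); first by rewrite ge_min lexx.
by apply: capped_dist_ball; rewrite ?ge_min ?lexx ?orbT// xy0.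
Qed.

End capped_dist.

(** Alias of [T] whose distance is [capped_dist]; the Hausdorff proof is an argument of the type
    because it supplies the separation axiom. Products of metric spaces become in this way the
    metric spaces that [metrizable] and [standard_borel] ask for. *)
Definition metrized (R : realType) (T : pseudoMetricType R)
  (_ : hausdorff_space T) : Type := T.

HB.instance Definition _ (R : realType) (T : pseudoMetricType R)
    (hT : hausdorff_space T) :=
  Choice.on (metrized hT).

HB.instance Definition _ (R : realType) (T : pseudoMetricType R)
    (hT : hausdorff_space T) :=
  isMetric.Build R (metrized hT) (@capped_distxx R T) (capped_dist_eq0 hT)
    (@capped_dist_sym R T) (@capped_dist_triangle R T).

Section metrized_topology.
Context (R : realType) (T : pseudoMetricType R) (hT : hausdorff_space T).

Let metrized_ballE (x : metrized hT) (e : R) :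
  ball x e = [set y : metrized hT | capped_dist (x : T) (y : T) < e].
Proof. by rewrite ballEmdist. Qed.

Lemma entourage_metrized (A : set (T * T)) :
  @entourage (metrized hT) A <-> @entourage T A.
Proof.
rewrite -!entourage_ballE; split=> -[e /= e0 eA].
  (* [ball_capped_dist] gives only a weak inequality; the factor 1/2 makes it strict. *)
  have m0 : 0 < Num.min e 1 / 2 by rewrite divr_gt0// lt_min e0 ltr01.
  exists (Num.min e 1 / 2) => //= -[x y] /= xy; apply: eA => /=.
  rewrite metrized_ballE/=; apply: le_lt_trans (ball_capped_dist m0 xy) _.
  by rewrite ltr_pdivrMr// mulr_natr mulr2n (@le_lt_trans _ _ e) ?ltrDl ?ge_min ?lexx.
exists (Num.min e 1) => /=; first by rewrite lt_min e0 ltr01.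
move=> [x y] /=; rewrite metrized_ballE/= => xy; apply: eA => /=.
apply: (@le_ball _ _ _ (Num.min e 1)); first by rewrite ge_min lexx.
by apply: capped_dist_ball => //; rewrite ge_min lexx orbT.
Qed.

Lemma nbhs_metrized (x : T) (A : set T) :
  @nbhs (metrized hT) (metrized hT) x A <-> nbhs x A.
Proof.
rewrite -!nbhs_entourageE; split=> -[E entE EA]; exists E => //.
  exact/entourage_metrized.
by apply/entourage_metrized.
Qed.

Lemma open_metrized (A : set T) : @open (metrized hT) A <-> open A.
Proof.
rewrite !openE; split => oA x Ax; have := oA x Ax; rewrite /interior/=.
  by move/nbhs_metrized.
by move=> ?; apply/nbhs_metrized.
Qed.

Lemma cauchy_cvg_metrized :
  (forall F : set_system T, ProperFilter F -> cauchy F -> exists l : T, F --> l) ->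
  forall F : set_system (metrized hT), ProperFilter F -> cauchy F ->
    exists l : metrized hT, F --> l.
Proof.
move=> cT F PF cF; have [l Fl] : exists l : T, (F : set_system T) --> l.
  by apply: cT => A /entourage_metrized; exact: cF.
by exists l => A /nbhs_metrized; exact: Fl.
Qed.

End metrized_topology.

Lemma homeomorphismP (S T : topologicalType) (phi : S -> T) :
  (bijective phi /\ forall U : set S, open U <-> open (phi @` U)) <->
  exists psi : T -> S,
    [/\ cancel phi psi, cancel psi phi, continuous phi & continuous psi].
Proof.
split=> [[[psi phiK psiK] phiO]|[psi [phiK psiK cphi cpsi]]].
  exists psi; split=> //; apply/continuousP => U oU.
    apply/phiO; rewrite image_preimage//.
    by apply/seteqP; split => // y _; exists (psi y).
  rewrite (_ : psi @^-1` U = phi @` U); first exact/phiO.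
  by apply/seteqP; split=> [y Uy|_ [x Ux <-]]; [exists (psi y)|rewrite /= phiK].
split; first by exists psi.
move=> U; rewrite (_ : phi @` U = psi @^-1` U); last first.
  by apply/seteqP; split=> [_ [x Ux <-]|y Uy]; [rewrite /= phiK|exists (psi y)].
split; first by move: U; by apply/continuousP.
move=> oU; rewrite -[U](_ : phi @^-1` (psi @^-1` U) = _); last first.
  by apply/seteqP; split => x /=; rewrite phiK.
by move: oU; move: (psi @^-1` U); by apply/continuousP.
Qed.

Lemma metrizableP (R : realType) (T : topologicalType) : metrizable R T <->
  exists (M : metricType R) (phi : T -> M) (psi : M -> T),
    [/\ cancel phi psi, cancel psi phi, continuous phi & continuous psi].
Proof.
split=> [[M [phi /homeomorphismP[psi ?]]]|[M [phi [psi phipsi]]]].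
  by exists M, phi, psi.
by exists M, phi; apply/homeomorphismP; exists psi.
Qed.

Lemma metrizable_hausdorff (R : realType) (T : topologicalType) :
  metrizable R T -> hausdorff_space T.
Proof.
move=> /metrizableP[M [phi [psi [phiK _ cphi _]]]] x y xy.
rewrite -[x]phiK -[y]phiK; congr psi; apply: metric_hausdorff => A B Ax By.
have [z [Az Bz]] := xy _ _ (cphi x _ Ax) (cphi y _ By).
by exists (phi z).
Qed.

Lemma metrizable_second_countable (R : realType) (T : ptopologicalType) :
  compact [set: T] -> metrizable R T -> @second_countable T.
Proof.
move=> cT /metrizableP[M [phi [psi [phiK psiK cphi cpsi]]]].
pose M' : pseudoPMetricType R :=
  HB.pack_for (pseudoPMetricType R) (Metric.sort M) (isPointed.Build M (phi point)).
have cM : compact [set: M'].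
  rewrite (_ : setT = phi @` setT); last first.
    by apply/seteqP; split=> // y _; exists (psi y).
  by apply: continuous_compact => //; exact: continuous_subspaceT.
have [B cB [oB bB]] := compact_second_countable cM.
exists [set phi @^-1` V | V in B]; first exact: card_le_trans (card_image_le _ _) cB.
split.
  by move=> _ [V BV <-]; move/continuousP : cphi; apply; exact: oB.
move=> x U; rewrite -{1}(phiK x) => /cpsi /bB [V [BV Vx] VU].
exists (phi @^-1` V); first by split => //; exists V.
by move=> z /VU /=; rewrite phiK.
Qed.

Lemma prod_continuous (S : topologicalType) I (T : I -> topologicalType)
    (f : S -> prod_topology T) :
  (forall i, continuous (fun x => f x i)) -> continuous f.
Proof.
move=> cf x; apply/cvg_sup => i; move: x.
apply/(@continuousP _ (initial_topology (@^~ i))) => A [B oB <-].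
rewrite -comp_preimage; move: B oB; by apply/continuousP.
Qed.

Lemma coord_continuous (I : eqType) (T : I -> topologicalType) (i : I) :
  continuous (fun f : prod_topology T => f i).
Proof. exact: (@proj_continuous I T i). Qed.

(** As [I] is countable, the power of [M] has a pseudometric structure for the product topology; it
    is Hausdorff since [M] is, so [metrized] applies. *)
Lemma metrizable_power (R : realType) (I : countType) (T : topologicalType) :
  metrizable R T -> metrizable R (prod_topology (fun _ : I => T)).
Proof.
move=> /metrizableP[M [phi [psi [phiK psiK cphi cpsi]]]].
pose P := prod_topology (fun _ : I => (M : pseudoMetricType R)).
have hP : hausdorff_space P.
  by apply: (@hausdorff_product I (fun _ => M)) => _; exact: metric_hausdorff.
have /continuousP cphiI : continuous
    ((fun f i => phi (f i)) : prod_topology (fun _ : I => T) -> P).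
  apply: prod_continuous => i f; 
  apply: (@continuous_comp _ _ _ (fun f : prod_topology (fun _ : I => T) => f i)).
    exact: coord_continuous.
  exact: cphi.
have /continuousP cpsiI : continuous
    ((fun f i => psi (f i)) : P -> prod_topology (fun _ : I => T)).
  apply: prod_continuous => i f; apply: (@continuous_comp _ _ _ (fun f : P => f i)).
    exact: coord_continuous.
  exact: cpsi.
apply/metrizableP; exists (metrized hP), (fun f i => phi (f i)), (fun f i => psi (f i)).
split.
- by move=> f; apply/funext => i.
- by move=> f; apply/funext => i.
- by apply/continuousP => A /open_metrized; exact: cphiI.
- by apply/continuousP => A oA; apply/open_metrized; exact: cpsiI.
Qed.

(** The separate name carries the coordinatewise group structure. The Haar measure of this group
    makes the coordinates independent and Haar distributed, which turns it into a source of
    randomness. *)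
Definition powg (I : Type) (K : topologicalGroupType) : Type :=
  prod_topology (fun _ : I => K).

Section powg.
Context (I : choiceType) (K : topologicalGroupType).
Implicit Types f g h : powg I K.

HB.instance Definition _ :=
  Topological.copy (powg I K) (prod_topology (fun _ : I => K)).
HB.instance Definition _ := isPointed.Build (powg I K) (fun=> point).

Let mul f g : powg I K := fun i => (f i * g i)%g.
Let one : powg I K := fun=> 1%g.
Let inv f : powg I K := fun i => (f i)^-1%g.

Let mulA : associative mul.
Proof. by move=> f g h; apply/funext => i; exact: mulgA. Qed.

Let mul1 : left_id one mul.
Proof. by move=> f; apply/funext => i; exact: mul1g. Qed.

Let mulr1 : right_id one mul.
Proof. by move=> f; apply/funext => i; exact: mulg1. Qed.

Let mulV : left_inverse one inv mul.
Proof. by move=> f; apply/funext => i; exact: mulVg. Qed.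

Let mulrV : right_inverse one inv mul.
Proof. by move=> f; apply/funext => i; exact: mulgV. Qed.

HB.instance Definition _ := isGroup.Build (powg I K) mulA mul1 mulr1 mulV mulrV.

Lemma powg_coord_continuous (i : I) : continuous (fun f : powg I K => f i).
Proof. exact: (@coord_continuous I (fun _ => K)). Qed.

Lemma powg_continuous (S : topologicalType) (F : S -> powg I K) :
  (forall i, continuous (fun x => F x i)) -> continuous F.
Proof. exact: (@prod_continuous S I (fun _ => K)). Qed.

Let mulg_cont : continuous (fun x : powg I K * powg I K => (x.1 * x.2)%g).
Proof.
apply: powg_continuous => i x.
apply: (@cvg_mulg K _ (nbhs x) _ (fun x => x.1 i) (fun x => x.2 i) (x.1 i) (x.2 i)).
  apply: (@continuous_comp _ _ _ fst (fun f : powg I K => f i)).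
    exact: cvg_fst.
  exact: powg_coord_continuous.
apply: (@continuous_comp _ _ _ snd (fun f : powg I K => f i)).
  exact: cvg_snd.
exact: powg_coord_continuous.
Qed.

Let invg_cont : continuous (fun x : powg I K => (x^-1)%g).
Proof.
apply: powg_continuous => i x.
apply: (@cvg_invg K _ (nbhs x) _ (fun x => x i) (x i)).
exact: powg_coord_continuous.
Qed.

HB.instance Definition _ := PointedTopological_isTopologicalGroup.Build (powg I K)
  mulg_cont invg_cont.

Lemma powg_compact : compact [set: K] -> compact [set: powg I K].
Proof.
move=> cK; have := @tychonoff I (fun _ => K) (fun _ => setT) (fun _ => cK).
by rewrite (_ : [set f | _] = setT)//; apply/seteqP; split.
Qed.

Lemma powg_metrizable (R : realType) : countable [set: I] ->
  metrizable R K -> metrizable R (powg I K).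
Proof.
move=> /pcard_leP/unsquash f mK.
pose J : countType := HB.pack (Choice.sort I) (PCanIsCountable (in1TT 'funoK_f)).
exact: (metrizable_power J mK).
Qed.

End powg.

(** * Borel sigma-algebras of products *)

Lemma open_setX (S T : topologicalType) (U : set S) (V : set T) :
  open U -> open V -> open (U `*` V).
Proof.
move=> oU oV; rewrite openE => -[x y] [/= Ux Vy].
by exists (U, V) => //=; split; exact: open_nbhs_nbhs.
Qed.

Lemma countable_bigcup_measurable d (X : measurableType d) I (D : set I)
    (F : I -> set X) :
  countable D -> (forall i, D i -> measurable (F i)) ->
  measurable (\bigcup_(i in D) F i).
Proof.
move=> cD mF; have [->|[f]] : D = set0 \/ $|{surjfun [set: nat] >-> D}|.
- exact/pfcard_geP.
- by rewrite bigcup_set0.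
rewrite (_ : \bigcup_(i in D) F i = \bigcup_n F (f n)); last first.
  apply/seteqP; split=> [x [i Di Fx]|x [n _ Fx]].
    by have [n _ fn] := @surj _ _ _ _ f i Di; exists n => //; rewrite fn.
  by exists (f n) => //; exact: funS.
by apply: bigcupT_measurable => n; apply: mF; exact: funS.
Qed.

Lemma second_countable_prod (S T : topologicalType) :
  @second_countable S -> @second_countable T -> @second_countable (S * T)%type.
Proof.
move=> [B cB [oB bB]] [C cC [oC bC]].
exists [set U `*` V | U in B & V in C].
  rewrite (_ : [set _ | _ in _ & _ in _] =
      (fun UV => UV.1 `*` UV.2) @` (B `*` C)); last first.
    by apply/seteqP; split=> [_ [U BU [V CV <-]]|_ [[U V] [/= BU CV] <-]];
      [exists (U, V)|exists U => //; exists V].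
  exact: card_le_trans (card_image_le _ _) (countableX cB cC).
split.
  by move=> _ [U BU [V CV <-]]; apply: open_setX; [exact: oB|exact: oC].
move=> [x y] W [[U V] /= [/bB [U' [BU' U'x] U'U] /bC [V' [CV' V'y] V'V]] UVW].
exists (U' `*` V'); first by split => //; exists U' => //; exists V'.
by move=> [u v] [/U'U Uu /V'V Vv]; exact: (UVW (u, v)).
Qed.

Section borel_product.
Context (S T : ptopologicalType).

(** By second countability an open set of the product is a countable union of open rectangles. *)
Lemma borel_prod_measurable (A : set (S * T)) :
  @second_countable S -> @second_countable T ->
  open A -> measurable (A : set (borel S * borel T)).
Proof.
move=> [B cB [oB bB]] [C cC [oC bC]] oA.
pose D := [set UV | [/\ B UV.1, C UV.2 & UV.1 `*` UV.2 `<=` A]].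
have -> : A = \bigcup_(UV in D) (UV.1 `*` UV.2).
  apply/seteqP; split=> [[x y] Axy|[x y] [UV [_ _ +]]]; last exact.
  have := open_nbhs_nbhs (conj oA Axy).
  move=> [[U V] /= [/bB [U' [BU' U'x] U'U] /bC [V' [CV' V'y] V'V]] UVA].
  exists (U', V') => //; split => //= -[u v] [/U'U Uu /V'V Vv].
  exact: (UVA (u, v)).
apply: countable_bigcup_measurable.
  by apply: card_le_trans (subset_card_le _) (countableX cB cC) => -[U V] [].
by move=> [U V] [/oB oU /oC oV _]; apply: measurableX; exact: open_borel.
Qed.

End borel_product.

Lemma continuous2_measurable (S T U : ptopologicalType) (f : S * T -> U) :
  @second_countable S -> @second_countable T -> continuous f ->
  measurable_fun setT (f : borel S * borel T -> borel U).
Proof.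
move=> cS cT /continuousP cf; apply: measurable_fun_borel => V oV.
by apply: borel_prod_measurable => //; exact: cf.
Qed.

Lemma standard_borelP (R : realType) d (X : measurableType d) :
  standard_borel R X <->
  exists (M : completeMetricType R) (phi : X -> borel M) (psi : borel M -> X),
    [/\ @second_countable M, cancel phi psi, cancel psi phi,
      measurable_fun setT phi & measurable_fun setT psi].
Proof.
split=> [[M [phi [cM [psi phiK psiK] mphi]]]|[M [phi [psi [cM phiK psiK mphi mpsi]]]]].
  exists M, phi, psi; split=> // _ A mA; rewrite setTI.
    apply/mphi; rewrite image_preimage//.
    by apply/seteqP; split=> // y _; exists (psi y).
  have -> : psi @^-1` A = phi @` A.
    by apply/seteqP; split=> [y Ay|_ [x Ax <-]]; [exists (psi y)|rewrite /= phiK].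
  exact/mphi.
exists M, phi; split=> //; first by exists psi.
move=> A; rewrite (_ : phi @` A = psi @^-1` A); last first.
  by apply/seteqP; split=> [_ [x Ax <-]|y Ay]; [rewrite /= phiK|exists (psi y)].
split=> [mA|mA]; first by rewrite -[X in _ X]setTI; exact: mpsi.
rewrite -[A](_ : phi @^-1` (psi @^-1` A) = _); last first.
  by apply/seteqP; split => x /=; rewrite phiK.
by rewrite -[X in measurable X]setTI; exact: mphi.
Qed.

(** [L] is homeomorphic to a compact metric space [N], so the product of [M] and [N] is complete and
    second countable, and [metrized] makes it a metric space. Its Borel sigma-algebra is the product
    one: open sets are measurable for the product by [borel_prod_measurable], and the projections
    are continuous. *)
Lemma standard_borel_prod (R : realType) d (X : measurableType d) (L : ptopologicalType) :
  standard_borel R X -> compact [set: L] -> metrizable R L ->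
  standard_borel R (X * borel L)%type.
Proof.
move=> /standard_borelP[M [f [g [cM fK gK mf mg]]]] cL mL.
move: mL => /metrizableP[N0 [u [v [uK vK cu cv]]]].
pose N : pseudoPMetricType R :=
  HB.pack_for (pseudoPMetricType R) (Metric.sort N0) (isPointed.Build N0 (u point)).
have cN : compact [set: N].
  rewrite (_ : setT = u @` setT); last first.
    by apply/seteqP; split=> // y _; exists (v y).
  by apply: continuous_compact => //; exact: continuous_subspaceT.
have cN2 := compact_second_countable cN.
pose P : pseudoMetricType R := (M * N)%type.
have hP : hausdorff_space P.
  move=> [x y] [x' y'] xy; congr pair.
    apply: (@metric_hausdorff R M) => A B Ax Bx.
    have [[s t] [/= As Bs]] := xy (fst @^-1` A) (fst @^-1` B)
      (@cvg_fst _ _ (nbhs x) (nbhs y) _ A Ax) (@cvg_fst _ _ (nbhs x') (nbhs y') _ B Bx).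
    by exists s.
  apply: (@metric_hausdorff R N0) => A B Ay By.
  have [[s t] [/= As Bs]] := xy (snd @^-1` A) (snd @^-1` B)
    (@cvg_snd _ _ (nbhs x) (nbhs y) _ A Ay) (@cvg_snd _ _ (nbhs x') (nbhs y') _ B By).
  by exists t.
(* The two projections of a Cauchy filter are Cauchy; one converges because [M] is complete, the
   other because [N] is compact. *)
have cP : forall F : set_system P, ProperFilter F -> cauchy F -> exists l : P, F --> l.
  move=> F PF /cauchy_ballP cF.
  have /cvg_ex[l Fl] : cvg (fst @ F).
    apply: cauchy_cvg; apply/cauchy_ballP => e e0.
    have [[A B] [/= FA FB] AB] := cF e e0; exists (fst @` A, fst @` B) => /=.
      by split; [apply: (filterS _ FA)|apply: (filterS _ FB)] => x; exists x.
    by move=> [x' y'] [/= [x Ax <-] [y By <-]]; have [] := AB (x, y) (conj Ax By).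
  have /cvg_ex[r Fr] : cvg (snd @ F).
    apply: (@compact_cauchy_cvg N setT) => //; last exact: filterT.
    apply/cauchy_ballP => e e0.
    have [[A B] [/= FA FB] AB] := cF e e0; exists (snd @` A, snd @` B) => /=.
      by split; [apply: (filterS _ FA)|apply: (filterS _ FB)] => x; exists x.
    by move=> [x' y'] [/= [x Ax <-] [y By <-]]; have [] := AB (x, y) (conj Ax By).
  exists (l, r) => W [[A B] [/= /Fl FA /Fr FB] ABW].
  have FAB : F (fst @^-1` A `&` snd @^-1` B) by exact: (@filterI _ F _ _ _ FA FB).
  apply: (@filterS _ F _ _ _ _ FAB) => -[x y] [/= Ax By].
  exact: (ABW (x, y)).
pose Q0 : pseudoPMetricType R :=
  HB.pack_for (pseudoPMetricType R) (metrized hP)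
    (isPointed.Build (metrized hP) (point, point)).
have cQ : forall F : set_system Q0, ProperFilter F -> cauchy F -> cvg F.
  move=> F PF cF; have [l Fl] := cauchy_cvg_metrized cP PF cF.
  by apply/cvg_ex; exists l; exact: Fl.
pose Q : completeMetricType R :=
  HB.pack_for (completeMetricType R) (PseudoPointedMetric.sort Q0)
    (Metric.class (metrized hP)) (Uniform_isComplete.Build Q0 cQ).
have openQ (A : set Q) : open A <-> open (A : set P) by exact: open_metrized.
apply/standard_borelP; exists Q.
exists (fun x => (f x.1, u x.2)), (fun y : borel Q => (g y.1, v y.2)).
split.
- have [B cB [oB bB]] := second_countable_prod cM cN2.
  exists B => //; split; first by move=> V BV; apply/openQ; exact: oB.
  by move=> x V nV; apply: (bB (x : P) V); exact: (nbhs_metrized hP (x : P) V).1 nV.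
- by move=> [x y] /=; rewrite fK uK.
- by move=> [x y] /=; rewrite gK vK.
- apply: measurable_fun_borel => V /openQ oV.
  have mV := @borel_prod_measurable M N V cM cN2 oV.
  have mfu : measurable_fun setT (fun x : X * borel L => (f x.1, u x.2 : borel N)).
    apply: measurable_fun_pair; first by apply: measurableT_comp mf _.
    apply: (@measurableT_comp _ _ _ _ _ _ (u : borel L -> borel N)) => //.
    exact: continuous_borel.
  by rewrite -[X in measurable X]setTI; exact: mfu.
- have ofst (U : set M) : open U -> open (fst @^-1` U : set P).
    by move: U; apply/continuousP => x; exact: cvg_fst.
  have osnd (U : set N) : open U -> open (snd @^-1` U : set P).
    by move: U; apply/continuousP => x; exact: cvg_snd.
  have mfst : measurable_fun setT (fst : borel Q -> borel M).
    by apply: measurable_fun_borel => U /ofst /openQ; exact: open_borel.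
  have msnd : measurable_fun setT (snd : borel Q -> borel N).
    by apply: measurable_fun_borel => U /osnd /openQ; exact: open_borel.
  have mv : measurable_fun setT (v : borel N -> borel L) by exact: continuous_borel.
  apply: measurable_fun_pair; first exact: measurableT_comp mg mfst.
  exact: measurableT_comp mv msnd.
Qed.

(** * Uniqueness of the Haar measure *)

Section haar.
Context (R : realType) (K : topologicalGroupType).
Context (cK : compact [set: K]) (mK : metrizable R K).
Implicit Types (m : probability (borel K) R) (A B : set (borel K)) (g k : K).

Let cK2 : @second_countable K := metrizable_second_countable cK mK.

Lemma measurable_mulg d (X : measurableType d) (F1 F2 : X -> K) :
  measurable_fun setT (F1 : X -> borel K) -> measurable_fun setT (F2 : X -> borel K) ->
  measurable_fun setT (fun x => (F1 x * F2 x)%g : borel K).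
Proof.
move=> mF1 mF2.
have mM := @continuous2_measurable K K K _ cK2 cK2 (@mulg_continuous K).
exact: (measurableT_comp mM (measurable_fun_pair mF1 mF2)).
Qed.

Lemma measurable_invg d (X : measurableType d) (F : X -> K) :
  measurable_fun setT (F : X -> borel K) ->
  measurable_fun setT (fun x => (F x)^-1%g : borel K).
Proof.
move=> mF; exact: (measurableT_comp (continuous_borel (@invg_continuous K)) mF).
Qed.

Lemma measurable_lmul k B : measurable B -> measurable ((lmul k @^-1` B) : set (borel K)).
Proof.
move=> mB; rewrite -[X in measurable X]setTI.
by apply: (continuous_borel (@lmulg_continuous K k)).
Qed.

Lemma measurable_preimage_invg B : measurable B ->
  measurable ([set k | B (k^-1)%g] : set (borel K)).
Proof.
move=> mB; rewrite -[X in measurable X]setTI.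
by apply: (continuous_borel (@invg_continuous K)).
Qed.

Lemma haar_lmul m : normalized_haar m ->
  forall k B, measurable B -> m (lmul k @^-1` B) = m B.
Proof.
by move=> hm k B mB; rewrite -(hm (k^-1)%g B mB) translateE invgK.
Qed.

(* The probability of the event (D and k^-1 Z in B) is averaged over a Haar
   distributed k: for fixed k it does not depend on k, and for fixed Z the
   measure of the k is that of B^-1. *)
Let invariant_law0 m (hm : normalized_haar m) d (O : measurableType d)
    (P : probability O R) (D : set O) (Z : O -> K) :
  measurable D -> measurable_fun setT (Z : O -> borel K) ->
  (forall k B, measurable B ->
    P (D `&` [set w | B (k * Z w)%g]) = P (D `&` Z @^-1` B)) ->
  forall B, measurable B -> P (D `&` Z @^-1` B) = (m [set k | B (k^-1)%g] * P D)%E.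
Proof.
move=> mD mZ ZD B mB.
pose E : set (borel K * O) := (snd @^-1` D) `&` [set x | B ((x.1 : K)^-1 * Z x.2)%g].
have mE : measurable E.
  apply: measurableI; first by rewrite -[X in measurable X]setTI; exact: measurable_snd.
  rewrite -[X in measurable X]setTI; apply: measurable_mulg => //.
    by apply: measurable_invg; exact: measurable_fst.
  exact: measurableT_comp mZ _.
have : (m \x P)%E E = (m \x^ P)%E E.
  by apply: product_measure_unique => // A C mA mC; exact: product_measure2E.
rewrite /product_measure1 /product_measure2 /=.
under eq_integral => k _.
  rewrite /= (_ : xsection E k = D `&` [set w | B (k^-1 * Z w)%g]); last first.
    by apply/seteqP; split=> w; rewrite /xsection/= inE.
  rewrite ZD//.
  over.
rewrite integral_cst//= probability_setT mule1 => ->.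
have -> : (\int[P]_x (m \o ysection E) x =
    \int[P]_x (m [set k | B (k^-1)%g] * (\1_D x)%:E))%E.
  apply: eq_integral => w _ /=.
  rewrite indicE; case: (boolP (w \in D)) => Dw; rewrite ?mule1 ?mule0.
    rewrite -[RHS](haar_lmul hm (Z w)^-1%g).
      congr (m _); apply/seteqP; split=> k; rewrite /ysection/= inE/= invgM invgK.
        by case.
      by split=> //; exact: set_mem.
    exact: measurable_preimage_invg.
  rewrite (_ : ysection E w = set0) ?measure0//.
  apply/seteqP; split=> k //; rewrite /ysection/= inE/= => -[Dw' _].
  by move: Dw; rewrite notin_setE.
rewrite ge0_integralZl//=.
  by rewrite integral_indic// setIT.
by apply/measurable_EFinP; exact: measurable_indic.
Qed.

(** This is [invariant_law0] for the identity of [K] under [m] itself. *)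
Lemma haar_invg m : normalized_haar m ->
  forall B, measurable B -> m [set k | B (k^-1)%g] = m B.
Proof.
move=> hm B mB.
have := @invariant_law0 m hm _ (borel K) m setT id measurableT (@measurable_id _ _ _).
move=> /(_ _ B mB); rewrite !setTI probability_setT mule1 => <- // k C mC.
by rewrite !setTI; exact: haar_lmul.
Qed.

(** [haar_invg] removes the inverse from [invariant_law0]. With [D] the whole space this is the
    uniqueness of the Haar measure; in general it also makes [Z] independent of [D], and the
    independence of the noise coordinates comes from here. *)
Lemma invariant_law m d (O : measurableType d) (P : probability O R)
    (D : set O) (Z : O -> K) : normalized_haar m ->
  measurable D -> measurable_fun setT (Z : O -> borel K) ->
  (forall k B, measurable B ->
    P (D `&` [set w | B (k * Z w)%g]) = P (D `&` Z @^-1` B)) ->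
  forall B, measurable B -> P (D `&` Z @^-1` B) = (m B * P D)%E.
Proof. by move=> hm mD mZ ZD B mB; rewrite (invariant_law0 hm)// haar_invg. Qed.

(** Inversion preserves [m] and turns right translations into left ones. *)
Lemma haar_rmul m : normalized_haar m ->
  forall k B, measurable B -> m [set x | B (x * k)%g] = m B.
Proof.
move=> hm k B mB; rewrite -haar_invg//; last first.
  rewrite -[X in measurable X]setTI.
  by apply: (continuous_borel (@rmulg_continuous K k)).
rewrite -[RHS]haar_invg// -[RHS](haar_lmul hm (k^-1)%g).
  by congr (m _); apply/seteqP; split => x /=; rewrite invgM invgK.
exact: measurable_preimage_invg.
Qed.

(** Uniqueness of the Haar measure lets a fixed [m] replace the measure quantified in
    [haar_distributed]. *)
Lemma haar_distributedP m d (X : measurableType d) (mu : probability X R) (F : X -> K) :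
  normalized_haar m -> haar_distributed mu F <->
  forall B, measurable B -> mu (F @^-1` B) = m B.
Proof.
move=> hm; split=> [[m' hm' Fm'] B mB|Fm]; last by exists m.
rewrite -[LHS]/(pushforward mu (F : X -> borel K) B) Fm'//.
have := @invariant_law m _ (borel K) m' setT id hm measurableT (@measurable_id _ _ _).
move=> /(_ _ B mB); rewrite !setTI probability_setT mule1; apply => k C mC.
by rewrite !setTI; exact: haar_lmul.
Qed.

(** By compactness finitely many translates of [U] cover [K]; if [U] were null, [K] would be
    null. *)
Lemma haar_open_gt0 m (U : set K) :
  normalized_haar m -> open U -> U !=set0 -> (0 < m U)%E.
Proof.
move=> hm oU [x Ux]; rewrite lt_neqAle measure_ge0 andbT; apply/eqP => U0.
have : finite_subset_cover [set: K] (fun g => lmul g @^-1` U) [set: K].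
  move: cK; rewrite compact_cover; apply.
    by move=> g _; apply: open_comp => // z _; exact: lmulg_continuous.
  by move=> y _; exists (x * y^-1)%g => //=; rewrite mulgVK.
move=> [D _ KD].
have : (m setT <= \sum_(g \in [set` finmap.enum_fset D]) m (lmul g @^-1` U))%E.
  apply: content_sub_fsum; [exact: finite_seq| |exact: measurableT|].
    by move=> g _; apply: measurable_lmul; exact: open_borel.
  by move=> y _; have [g gD gU] := KD y I; exists g.
rewrite fsbig1 ?probability_setT ?lee_fin ?ler10// => g _.
by rewrite haar_lmul//; exact: open_borel.
Qed.

End haar.

(** * Bounded measurable functions and products of systems *)

Section product_law.
Context (R : realType) d (O : measurableType d) (P : probability O R).

Lemma product_law d1 d2 (T1 : measurableType d1) (T2 : measurableType d2)
    (m1 : probability T1 R) (m2 : probability T2 R) (f : O -> T1 * T2) :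
  measurable_fun setT f ->
  (forall A B, measurable A -> measurable B -> P (f @^-1` (A `*` B)) = (m1 A * m2 B)%E) ->
  forall E, measurable E -> P (f @^-1` E) = (m1 \x m2)%E E.
Proof.
move=> mf fAB E mE; apply/esym.
exact: (@product_measure_unique _ _ _ _ _ m1 m2
  (measure_function_pushforward__canonical__measure_function_Measure P mf)).
Qed.

Lemma product_measure_ysection d2 (T : measurableType d2) (m : probability T R)
    (E : set (O * T)) : measurable E ->
  (P \x m)%E E = (\int[m]_y P (ysection E y))%E.
Proof.
move=> mE; rewrite -[RHS]/((P \x^ m)%E E).
by apply: product_measure_unique => // A C mA mC; exact: product_measure2E.
Qed.

End product_law.

Section bounded_measurable.
Context (R : realType) d (X : measurableType d).
Implicit Types (f g : X -> R) (E : set X).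

Definition bmeas f := measurable_fun setT f /\ exists C, forall x, `|f x| <= C.

Lemma bmeas_cst r : bmeas (cst r).
Proof. by split=> //; exists `|r|. Qed.

Lemma bmeasD f g : bmeas f -> bmeas g -> bmeas (fun x => f x + g x).
Proof.
move=> [mf [C fC]] [mg [D gD]]; split; first exact: measurable_funD.
by exists (C + D) => x; rewrite (le_trans (ler_normD _ _))// lerD.
Qed.

Lemma bmeasM f g : bmeas f -> bmeas g -> bmeas (fun x => f x * g x).
Proof.
move=> [mf [C fC]] [mg [D gD]]; split; first exact: measurable_funM.
by exists (C * D) => x; rewrite normrM ler_pM.
Qed.

Lemma bmeasB f g : bmeas f -> bmeas g -> bmeas (fun x => f x - g x).
Proof.
move=> bf [mg [D gD]]; apply: bmeasD => //; split; first exact: measurableT_comp.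
by exists D => x; rewrite normrN.
Qed.

Lemma bmeas_indic E : measurable E -> bmeas (\1_E).
Proof.
move=> mE; split; first exact: measurable_indic.
by exists 1 => x; rewrite indicE ger0_norm// lern1; case: (_ \in _).
Qed.

Context (P : probability X R).

Lemma bmeas_integrable f : bmeas f -> P.-integrable setT (EFin \o f).
Proof.
move=> [mf [C fC]]; apply: measurable_bounded_integrable => //.
  by apply: (le_lt_trans (probability_le1 P measurableT)); rewrite ltry.
exists C; split; first exact: num_real.
by move=> D CD x _ /=; rewrite (le_trans (fC x))// ltW.
Qed.

Lemma Rintegral_indic E : measurable E -> \int[P]_x \1_E x = fine (P E).
Proof. by move=> mE; rewrite /Rintegral integral_indic// setIT. Qed.

Lemma Rintegral_cst1 r : \int[P]_x r = r.
Proof.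
transitivity (r * fine (P setT)); first exact: Rintegral_cst.
by rewrite probability_setT mulr1.
Qed.

Lemma EFin_Rintegral f : bmeas f -> (\int[P]_x f x)%:E = (\int[P]_x (f x)%:E)%E.
Proof.
by move=> bf; rewrite fineK//; apply: integrable_fin_num => //; exact: bmeas_integrable.
Qed.

Lemma Rintegral_bmeasD f g : bmeas f -> bmeas g ->
  \int[P]_x (f x + g x) = \int[P]_x f x + \int[P]_x g x.
Proof. by move=> bf bg; rewrite RintegralD//; exact: bmeas_integrable. Qed.

Lemma Rintegral_bmeasB f g : bmeas f -> bmeas g ->
  \int[P]_x (f x - g x) = \int[P]_x f x - \int[P]_x g x.
Proof. by move=> bf bg; rewrite RintegralB//; exact: bmeas_integrable. Qed.

Lemma Rintegral_bmeasZ f r : bmeas f -> \int[P]_x (r * f x) = r * \int[P]_x f x.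
Proof. by move=> bf; rewrite RintegralZl//; exact: bmeas_integrable. Qed.

End bounded_measurable.

Lemma bmeas_comp (R : realType) d d' (X : measurableType d) (Y : measurableType d')
  (T : Y -> X) (f : X -> R) :
  measurable_fun setT T -> bmeas f -> bmeas (fun y => f (T y)).
Proof.
by move=> mT [mf [C fC]]; split; [exact: measurableT_comp mf mT|exists C].
Qed.

Section mps.
Context (R : realType) (G : groupType) d (X : measurableType d) (mu : probability X R)
  (T : G -> X -> X) (mpsT : is_mps mu T).

Lemma Rintegral_mps g (f : X -> R) : bmeas f ->
  \int[mu]_x f (T g x) = \int[mu]_x f x.
Proof.
move=> bf; have [mf _] := bf.
have mT := mps_measurable mpsT g; have bfT := bmeas_comp mT bf.
rewrite /Rintegral; congr fine.
rewrite -(@integral_pushforward _ _ _ _ _ (T g) mT mu setT (EFin \o f)) ?preimage_setT//.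
- apply: eq_measure_integral => A mA _; exact: mps_preserving.
- exact/measurable_EFinP.
- exact: bmeas_integrable.
Qed.

Lemma mps_prod (L : ptopologicalType) (nu : probability (borel L) R) (S : G -> L -> L) :
  compact [set: L] -> metrizable R L ->
  (forall x, S 1%g x = x) -> (forall g h x, S (g * h)%g x = S g (S h x)) ->
  (forall g, continuous (S g)) ->
  (forall g (A : set (borel L)), measurable A -> nu (S g @^-1` A) = nu A) ->
  is_mps (mu \x nu)%E (fun g (y : X * borel L) => (T g y.1, S g y.2 : borel L)).
Proof.
move=> cL mL S1 SM cS nuS.
have mTS g : measurable_fun setT (fun y : X * borel L => (T g y.1, S g y.2 : borel L)).
  apply: measurable_fun_pair.
    exact: measurableT_comp (mps_measurable mpsT g) _.
  exact: (measurableT_comp (continuous_borel (cS g)) (@measurable_snd _ _ X (borel L))).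
split=> //.
- by apply: standard_borel_prod => //; exact: mps_standard mpsT.
- by move=> [x y] /=; rewrite (mps_act1 mpsT) S1.
- by move=> g h [x y] /=; rewrite (mps_actM mpsT) SM.
move=> g A mA; apply: product_law => // B C mB mC.
rewrite (_ : _ @^-1` _ = (T g @^-1` B) `*` (S g @^-1` C))//.
have mTB : measurable (T g @^-1` B).
  by rewrite -[X in measurable X]setTI; exact: (mps_measurable mpsT).
have mSC : measurable (S g @^-1` C : set (borel L)).
  by rewrite -[X in measurable X]setTI; exact: (continuous_borel (cS g)).
apply: (eq_trans (product_measure1E mu nu mTB mSC)).
by congr (_ * _)%E; [exact: (mps_preserving mpsT)|exact: nuS].
Qed.

Lemma mps_static (L : ptopologicalType) (nu : probability (borel L) R) :
  compact [set: L] -> metrizable R L ->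
  is_mps (mu \x nu)%E (fun g (y : X * borel L) => (T g y.1, y.2)).
Proof.
by move=> cL mL; apply: (@mps_prod L nu (fun _ x => x)) => // g x; exact: cvg_id.
Qed.

End mps.

(** * Real and imaginary parts of complex Borel functions *)

Section complex_borel.
Context (R : realType).

(** The norm of [R[i]] takes values in [R[i]], and so do the radii of balls; positivity forces a
    radius to be real. *)
Let nbhs_RiP (z : R[i]) (A : set R[i]^o) : nbhs (z : R[i]^o) A <->
  exists2 e : R, 0 < e & forall w, `|z - w| < e%:C%C -> A w.
Proof.
rewrite nbhs_ballP; split=> [[[e e'] /=]|[e e0 eA]].
  rewrite ltcE/= => /andP[/eqP -> e0] eA; exists e => // w; exact: eA.
by exists e%:C%C; [rewrite /= ltcR|move=> w; exact: eA].
Qed.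

Lemma real_complex_continuous : continuous (fun x : R => x%:C%C : R[i]^o).
Proof.
move=> x A /nbhs_RiP[e e0 eA]; apply/nbhs_ballP; exists e => // y xy; apply: eA.
by rewrite -rmorphB/= normc_def/= expr0n addr0 sqrtr_sqr ltcR.
Qed.

Let Re_continuous : continuous (fun z : R[i]^o => complex.Re z : R).
Proof.
move=> z A /nbhs_ballP[e /= e0 eA]; apply/nbhs_RiP; exists e => // w zw; apply: eA.
rewrite /ball/= -ltcR; apply: le_lt_trans zw.
by case: z w => [a b] [c d]; exact: (normc_ge_Re (Complex (a - c) (b - d))).
Qed.

Let normc_ge_Im (z : R[i]) : `|complex.Im z|%:C%C <= `|z|.
Proof. by rewrite normc_def lecR -sqrtr_sqr ler_wsqrtr// lerDr sqr_ge0. Qed.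

Let Im_continuous : continuous (fun z : R[i]^o => complex.Im z : R).
Proof.
move=> z A /nbhs_ballP[e /= e0 eA]; apply/nbhs_RiP; exists e => // w zw; apply: eA.
rewrite /ball/= -ltcR; apply: le_lt_trans zw.
by case: z w => [a b] [c d]; exact: (normc_ge_Im (Complex (a - c) (b - d))).
Qed.

Context d (X : measurableType d).

Lemma measurable_real_complex (r : X -> R) : measurable_fun setT r ->
  measurable_fun setT ((fun x => (r x)%:C%C) : X -> borel R[i]^o).
Proof.
move=> mr; apply: measurable_fun_borel => U oU.
have oV : open ((fun x : R => x%:C%C : R[i]^o) @^-1` U).
  by move: U oU; apply/continuousP; exact: real_complex_continuous.
by have := mr measurableT _ (open_measurable oV); rewrite setTI.
Qed.

Let measurable_continuous (f : X -> R[i]^o) (p : R[i]^o -> R) :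
  measurable_fun setT (f : X -> borel R[i]^o) -> continuous p ->
  measurable_fun setT (p \o f).
Proof.
move=> mf /continuousP cp.
apply: (@measurability _ _ X R setT _ (@RGenOInfty.G R)).
  exact: RGenOInfty.measurableE.
move=> _ [_ [x ->] <-].
have := mf measurableT _ (open_borel (cp _ (rray_open x))).
by rewrite setTI.
Qed.

Lemma bmeas_Re_Im (f : X -> R[i]) :
  measurable_fun setT (f : X -> borel R[i]^o) ->
  (exists C : R, forall x, `|f x| <= C%:C%C) ->
  bmeas (fun x => complex.Re (f x)) /\ bmeas (fun x => complex.Im (f x)).
Proof.
move=> mf [C fC]; split; split; try exact: measurable_continuous mf _.
  by exists C => x; rewrite -lecR (le_trans (normc_ge_Re _)).
by exists C => x; rewrite -lecR (le_trans (normc_ge_Im _)).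
Qed.

End complex_borel.

Lemma vdC_bmeas (R : realType) (G : groupType) (H : set G) : vdC R H ->
  forall d (X : measurableType d) (mu : probability X R) (T : G -> X -> X),
  is_mps mu T -> forall r : X -> R, bmeas r ->
  (forall h, H h -> \int[mu]_x (r (T h x) * r x) = 0) -> \int[mu]_x r x = 0.
Proof.
move=> vH d X mu T mT r [mr [C rC]] rH.
suff: Cintegral mu (fun x => (r x)%:C%C) = 0 by case.
apply: vH mT _ (measurable_real_complex mr) _ _.
  by exists C => x; rewrite normc_def/= expr0n addr0 sqrtr_sqr lecR.
move=> h Hh; rewrite /Cintegral.
under eq_Rintegral do rewrite /= ?(oppr0, mulr0, mul0r, addr0).
under [X in Complex _ X]eq_Rintegral do rewrite /= ?(oppr0, mulr0, mul0r, addr0).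
by rewrite rH// Rintegral_cst1.
Qed.

Lemma measurable_preimage d d' (X : measurableType d) (Y : measurableType d')
    (f : X -> Y) (A : set Y) :
  measurable_fun setT f -> measurable A -> measurable (f @^-1` A).
Proof. by move=> mf mA; rewrite -[X in measurable X]setTI; exact: mf. Qed.

Lemma xsectionE T1 T2 (B : set (T1 * T2)) x : xsection B x = [set y | B (x, y)].
Proof. by apply/seteqP; split => y; rewrite /xsection/= inE. Qed.

Lemma ysectionE T1 T2 (B : set (T1 * T2)) y : ysection B y = [set x | B (x, y)].
Proof. by apply/seteqP; split => x; rewrite /ysection/= inE. Qed.

(** * vdC sets are measure-theoretic vdC sets *)

Section vdC_mt_vdC.
Context (R : realType) (G : groupType) (K : topologicalGroupType) (H : set G).
Context (cK : compact [set: K]) (mK : metrizable R K).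
Context d (X : measurableType d) (mu : probability X R) (T : G -> X -> X).
Context (mpsT : is_mps mu T) (F : X -> K) (mF : measurable_fun setT (F : X -> borel K)).
Context (m : probability (borel K) R) (hm : normalized_haar m).

Let P := (mu \x m)%E.
Let E A : set (X * borel K) := [set y | A (F y.1 * y.2)%g].

Let mFk : measurable_fun setT (fun y : X * borel K => (F y.1 * y.2)%g : borel K).
Proof.
apply: (measurable_mulg cK mK); last exact: measurable_snd.
exact: measurableT_comp mF _.
Qed.

Let measurable_E A : measurable (A : set (borel K)) -> measurable (E A).
Proof. exact: measurable_preimage mFk. Qed.

Let PE (A : set (borel K)) : measurable A -> P (E A) = m A.
Proof.
move=> mA; rewrite /P /product_measure1.
under eq_integral => x _ do rewrite /= xsectionE (haar_lmul hm (F x) mA).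
by rewrite integral_cst//= probability_setT mule1.
Qed.

(** Substituting F(x)^-1 k for k turns the event into [B]. For fixed k in [A], the slice of [B] says
    that F(T_h x) F(x)^-1 lies in the right translate of [A] by k^-1, an event of probability [m A];
    for other k the slice is empty. *)
Let PEE (A : set (borel K)) h : measurable A ->
  haar_distributed mu (fun x => F (T h x) * (F x)^-1)%g ->
  P ([set y | A (F (T h y.1) * y.2)%g] `&` E A) = (m A * m A)%E.
Proof.
move=> mA /(haar_distributedP cK mK _ _ hm) hF.
have mFT : measurable_fun setT (fun x => F (T h x) : borel K).
  exact: measurableT_comp mF (mps_measurable mpsT h).
pose B : set (X * borel K) :=
  [set y | A (F (T h y.1) * (F y.1)^-1 * y.2)%g] `&` [set y | A y.2].
have mB : measurable B.
  have mD : measurable_fun setT (fun y : X * borel K =>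
      (F (T h y.1) * (F y.1)^-1 * y.2)%g : borel K).
    apply: (measurable_mulg cK mK); last exact: measurable_snd.
    apply: (measurable_mulg cK mK); first exact: (measurableT_comp mFT).
    apply: (@measurable_invg K _ (X * borel K)%type (fun y => F y.1)).
    exact: (measurableT_comp mF).
  apply: measurableI; first exact: measurable_preimage mD mA.
  exact: measurable_preimage measurable_snd mA.
transitivity (P B).
  rewrite /P /product_measure1; apply: eq_integral => x _ /=.
  rewrite !xsectionE -[LHS](haar_lmul hm (F x)^-1%g); last first.
    apply: (@measurableI _ (borel K) (lmul (F (T h x)) @^-1` A) (lmul (F x) @^-1` A));
      exact: measurable_lmul.
  by congr (m _); apply/seteqP; split=> k /=; rewrite /E /B/= !mulgA mulgV mul1g.
rewrite /P product_measure_ysection//.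
rewrite (@eq_integral _ _ _ _ _ (fun k => (m A)* (\1_A k)%:E)%E).
  rewrite ge0_integralZl// ?integral_indic ?setIT//.
  by apply/measurable_EFinP; exact: measurable_indic.
move=> k _; rewrite ysectionE indicE; case: (boolP (k \in A)) => kA.
  rewrite mule1 -(haar_rmul cK mK hm k mA) -hF; last first.
    exact: measurable_preimage (continuous_borel (@rmulg_continuous K k)) mA.
  congr (mu _); apply/seteqP; split=> x; first by case.
  by split=> //; exact: set_mem.
rewrite mule0 (_ : [set x | _] = set0) ?measure0//.
by apply/seteqP; split=> x // -[_ /= Ak]; move: kA; rewrite notin_setE.
Qed.

Context (vH : vdC R H).
Context (FH : forall h, H h -> haar_distributed mu (fun x => F (T h x) * (F x)^-1)%g).

(* Under P, the second coordinate k and F k are independent: c takes the values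
   1 and -1 and is invariant, so c e has the correlations of e. *)
Let joint_law (A B : set (borel K)) :
  measurable A -> measurable B -> P ([set y | B y.2] `&` E A) = (m B * m A)%E.
Proof.
move=> mA mB; set SB : set (X * borel K) := [set y | B y.2].
have mSB : measurable SB by exact: measurable_preimage measurable_snd mB.
have mEA := measurable_E mA.
pose a := fine (m A).
have mAE : m A = a%:E by rewrite fineK// fin_num_measure.
pose c (y : X * borel K) : R := 2 * \1_SB y - 1.
pose e (y : X * borel K) : R := \1_(E A) y - a.
have bSB := bmeas_indic R mSB; have bEA := bmeas_indic R mEA.
have be : bmeas e by apply: bmeasB => //; exact: bmeas_cst.
have bc : bmeas c.
  apply: bmeasB; last exact: bmeas_cst.
  by apply: bmeasM => //; exact: bmeas_cst.
have PEa : fine (P (E A)) = a by rewrite PE.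
pose TT g (y : X * borel K) := (T g y.1, y.2 : borel K).
have mpsTT : is_mps P TT by exact: mps_static.
have r0 : \int[P]_y (c y * e y) = 0.
  apply: (vdC_bmeas vH mpsTT) => [|h Hh]; first exact: bmeasM.
  pose Eh := TT h @^-1` E A.
  have mEh : measurable Eh.
    exact: measurable_preimage (mps_measurable mpsTT h) mEA.
  have PEh : fine (P Eh) = a.
    by rewrite -PEa; exact: (congr1 fine (mps_preserving mpsTT h mEA)).
  have PEEh : fine (P (Eh `&` E A)) = a * a.
    by rewrite (PEE mA (FH Hh)) mAE.
  (* [TT h] fixes the second coordinate, hence the value of [c], and the square of [c] is 1. *)
  have ceE y : c (TT h y) * e (TT h y) * (c y * e y) =
      \1_(Eh `&` E A) y - a * \1_Eh y - (a * \1_(E A) y - a * a).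
    rewrite indicI /c /e /=.
    rewrite (_ : \1_SB (TT h y) = \1_SB y)// (_ : \1_(E A) (TT h y) = \1_Eh y)//.
    by rewrite [\1_SB y]indicE; case: (y \in SB); rewrite /=; ring.
  have bEh := bmeas_indic R mEh.
  have bEhE := bmeas_indic R (measurableI _ _ mEh mEA).
  have ba f : bmeas f -> bmeas (fun y : X * borel K => a * f y).
    by move=> bf; apply: bmeasM => //; exact: bmeas_cst.
  under eq_Rintegral do rewrite ceE.
  rewrite Rintegral_bmeasB; last 2 first.
  - by apply: bmeasB => //; exact: ba.
  - by apply: bmeasB; [exact: ba|exact: bmeas_cst].
  rewrite Rintegral_bmeasB//; last exact: ba.
  rewrite Rintegral_bmeasB; [|exact: ba|exact: bmeas_cst].
  rewrite Rintegral_cst1 !Rintegral_bmeasZ// !Rintegral_indic//; last exact: measurableI.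
  by rewrite PEEh PEh PEa; ring.
(* Since [e] has mean 0, the vanishing mean of the left-hand side leaves the product formula for
   [SB] and [E A]. *)
have cE y : c y * e y = 2 * \1_(SB `&` E A) y - (2 * a) * \1_SB y - e y.
  by rewrite /c /e indicI/=; ring.
have bSE := bmeas_indic R (measurableI _ _ mSB mEA).
have bZ r f : bmeas f -> bmeas (fun y : X * borel K => r * f y).
  by move=> bf; apply: bmeasM => //; exact: bmeas_cst.
have PSB : fine (P SB) = fine (m B).
  congr fine.
  rewrite (_ : SB = setT `*` B); last by apply/seteqP; split => y // -[].
  transitivity (mu setT * m B)%E; last by rewrite probability_setT mul1e.
  exact: product_measure1E.
move: r0; under eq_Rintegral do rewrite cE.
rewrite Rintegral_bmeasB//; last by apply: bmeasB; exact: bZ.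
rewrite Rintegral_bmeasB; [|exact: bZ|exact: bZ].
rewrite Rintegral_bmeasB//; last exact: bmeas_cst.
rewrite !Rintegral_bmeasZ// !Rintegral_indic//; last exact: measurableI.
rewrite Rintegral_cst1 PEa PSB => PSE.
have {}PSE : fine (P (SB `&` E A)) = a * fine (m B) by lra.
rewrite -[LHS]fineK; last first.
  by apply: (fin_num_measure (P : probability _ R)); exact: measurableI.
by rewrite PSE mAE -[in RHS](@fineK _ (m B)) ?fin_num_measure// EFinM muleC.
Qed.

Lemma vdC_haar_distributed : haar_distributed mu F.
Proof.
apply/(haar_distributedP cK mK _ _ hm) => C mC.
pose f (y : X * borel K) : borel K * borel K := (y.2, (F y.1 * y.2)%g : borel K).
have mf : measurable_fun setT f.
  by apply: measurable_fun_pair => //; exact: measurable_snd.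
(* By [joint_law], [f] has law [m] times [m]. As (F(x) k) k^-1 = F(x), the preimage of [D] under [f]
   is given by that of [C] under [F]; by right invariance the product measure of [D] is [m C]. *)
pose D : set (borel K * borel K) := [set z | C (z.2 * (z.1 : K)^-1)%g].
have mD : measurable D.
  have mz : measurable_fun setT (fun z : borel K * borel K =>
      (z.2 * (z.1 : K)^-1)%g : borel K).
    apply: (measurable_mulg cK mK); first exact: measurable_snd.
    by apply: (@measurable_invg K _ (borel K * borel K)%type fst); exact: measurable_fst.
  exact: measurable_preimage mz mC.
have fAB A B : measurable A -> measurable B -> P (f @^-1` (A `*` B)) = (m A * m B)%E.
  by move=> mA mB; exact: joint_law.
have := product_law mf fAB mD.
rewrite (_ : f @^-1` D = (F @^-1` C) `*` setT); last first.
  by apply/seteqP; split=> y; rewrite /f /D/= mulgK; [move=> ?; split|case].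
move=> PC; have mFC : measurable (F @^-1` C) by exact: measurable_preimage mF mC.
transitivity (mu (F @^-1` C) * m setT)%E; first by rewrite probability_setT mule1.
transitivity (P (F @^-1` C `*` setT)); first by apply/esym; exact: product_measure1E.
apply: (eq_trans PC); rewrite /product_measure1.
under eq_integral => k _ do rewrite /= xsectionE (haar_rmul cK mK hm k^-1%g mC).
by rewrite integral_cst//= probability_setT mule1.
Qed.

End vdC_mt_vdC.

Lemma vdC_mt_vdC (R : realType) (G : groupType) (K : topologicalGroupType) (H : set G) :
  compact [set: K] -> metrizable R K -> vdC R H -> mt_vdC R K H.
Proof.
move=> cK mK vH d X mu T mT F mF FH.
have [m hm] := normalized_haar_ex R cK (metrizable_hausdorff mK).
exact: (vdC_haar_distributed cK mK mT mF hm vH FH).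
Qed.

(** * Noise: Haar measure on a power of K *)

Section noise.
Context (R : realType) (K : topologicalGroupType) (I : choiceType).
Context (cK : compact [set: K]) (mK : metrizable R K) (cI : countable [set: I]).
Context (m : probability (borel K) R) (hm : normalized_haar m).
Let Om := powg I K.
Context (M : probability (borel Om) R) (hM : normalized_haar M).

Lemma measurable_coord (i : I) :
  measurable_fun setT ((fun w => w i) : borel Om -> borel K).
Proof. by apply: continuous_borel; exact: powg_coord_continuous. Qed.

(* The event D does not depend on the coordinates in J. *)
Definition free_of (J : set I) (D : set Om) :=
  forall w w' : Om, (forall i, ~ J i -> w i = w' i) -> D w -> D w'.

Lemma free_ofS (J J' : set I) (D : set Om) : J `<=` J' -> free_of J' D -> free_of J D.
Proof. by move=> JJ' fD w w' ww'; apply: fD => i nJ'; apply: ww' => /JJ'. Qed.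

Lemma free_ofI (J : set I) (D D' : set Om) :
  free_of J D -> free_of J D' -> free_of J (D `&` D').
Proof. by move=> fD fD' w w' ww' [Dw D'w]; split; [exact: fD Dw|exact: fD' D'w]. Qed.

Definition single (i : I) (k : K) : Om := fun j => if j == i then k else 1%g.

Lemma single_mulE i k (w : Om) j :
  (single i k * w)%g j = if j == i then (k * w j)%g else w j.
Proof.
rewrite -[LHS]/(single i k j * w j)%g /single.
by case: ifP => // _; rewrite mul1g.
Qed.

(** Left multiplication by [single i k] preserves [M], does not affect [D] and translates [Z] by
    [k], so [invariant_law] applies. *)
Lemma noise_law i (D : set (borel Om)) (Z : Om -> K) :
  measurable D -> measurable_fun setT (Z : borel Om -> borel K) ->
  free_of [set i] D -> (forall k w, Z (single i k * w)%g = (k * Z w)%g) ->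
  forall B : set (borel K), measurable B -> M (D `&` Z @^-1` B) = (m B * M D)%E.
Proof.
move=> mD mZ fD Zk; apply: (invariant_law cK mK hm mD mZ) => k B mB.
rewrite -[RHS](haar_lmul hM (single i k)); last first.
  by apply: measurableI => //; exact: measurable_preimage mZ mB.
congr (M _); apply/seteqP; split=> w /=; rewrite Zk => -[Dw Bw]; split=> //.
  by apply: fD Dw => j /= ji; rewrite single_mulE; case: eqP.
by apply: fD Dw => j /= ji; rewrite single_mulE; case: eqP.
Qed.

Lemma noise_coord i (D : set (borel Om)) (B : set (borel K)) :
  measurable D -> measurable B -> free_of [set i] D ->
  M (D `&` [set w | B (w i)]) = (m B * M D)%E.
Proof.
move=> mD mB fD; apply: (noise_law mD (measurable_coord i) fD) => // k w.
by rewrite single_mulE eqxx.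
Qed.

End noise.

(** * The shift action of [G] on the noise *)

Section shift.
Context (R : realType) (K : topologicalGroupType) (G : groupType) (J : choiceType).
Context (cK : compact [set: K]) (mK : metrizable R K).
Context (cG : countable [set: G]) (cJ : countable [set: J]).
Let Om := powg (G * J)%type K.

(** Multiplying the index on the right yields a left action. The second index gives each element of
    [G] its own family of coordinates: a pair for [pick], a sequence for [hit]. *)
Definition shift (g : G) (w : Om) : Om := fun a => w ((a.1 * g)%g, a.2).

Lemma countable_index : countable [set: (G * J)%type].
Proof. by rewrite -setXTT; exact: countableX. Qed.

(** Every translation of [Om] lifts through [shift g] to another translation, so the image of [M]
    under [shift g] is left invariant, and it equals [M] by uniqueness. *)
Lemma shift_mps (M : probability (borel Om) R) (hM : normalized_haar M)
    d (X : measurableType d) (mu : probability X R) (T : G -> X -> X) :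
  is_mps mu T ->
  is_mps (mu \x M)%E (fun g (y : X * borel Om) => (T g y.1, shift g y.2 : borel Om)).
Proof.
move=> mT; have cOm : compact [set: Om] by exact: powg_compact.
have mOm : metrizable R Om by exact: powg_metrizable countable_index mK.
have shiftc g : continuous (shift g).
  by apply: powg_continuous => a; exact: powg_coord_continuous.
apply: (mps_prod mT) => //.
- by move=> w; apply/funext => -[a j]; rewrite /shift/= mulg1.
- by move=> g h w; apply/funext => -[a j]; rewrite /shift/= mulgA.
move=> g A mA.
have ms := continuous_borel (shiftc g).
have := invariant_law cOm mOm hM measurableT ms.
move=> /(_ M _ A mA); rewrite !setTI probability_setT mule1; apply => k B mB.
rewrite !setTI.
have kE : exists k' : Om, forall w : Om, (k * shift g w)%g = shift g (k' * w)%g.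
  exists (shift g^-1%g k) => w; apply/funext => -[a j].
  rewrite -[LHS]/(k (a, j) * w ((a * g)%g, j))%g.
  by rewrite -[RHS]/(k ((a * g * g^-1)%g, j) * w ((a * g)%g, j))%g mulgK.
have [k' k'E] := kE.
rewrite -[RHS](haar_lmul hM k'); last exact: measurable_preimage ms mB.
by congr (M _); apply/seteqP; split=> w /=; rewrite k'E.
Qed.

End shift.

(** * Measure-theoretic vdC sets are vdC sets *)

(** Two distinct points have disjoint open neighbourhoods, both of positive measure; one of the two
    measures is at most 1/2. *)
Lemma haar_half_set (R : realType) (K : topologicalGroupType)
    (m : probability (borel K) R) :
  compact [set: K] -> hausdorff_space K -> (exists k : K, k <> 1%g) ->
  normalized_haar m ->
  exists2 A : set (borel K), measurable A & 0 < fine (m A) <= 2^-1.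
Proof.
move=> cK hK [k /eqP k1] hm.
have : exists U V : set K, [/\ open U, open V, U !=set0, V !=set0 & U `&` V = set0].
  move: hK; rewrite open_hausdorff => /(_ _ _ k1)[[U V]] /=.
  rewrite !inE => -[Uk V1] [oU oV UV].
  exists U, V; split; [exact: oU|exact: oV|by exists k|by exists 1%g|].
  by apply/funext => x; move/(congr1 (fun f => f x)) : UV.
move=> [U [V [oU oV U0 V0 UV]]].
have mU := open_borel oU; have mV := open_borel oV.
have gt0 W : open W -> W !=set0 -> 0 < fine (m W).
  move=> oW W0; rewrite fine_gt0// (haar_open_gt0 cK hm oW W0)/=.
  by apply: le_lt_trans (probability_le1 _ (open_borel oW)) _; rewrite ltry.
have UV1 : fine (m U) + fine (m V) <= 1.
  rewrite -lee_fin EFinD !fineK ?fin_num_measure// -measureU//.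
  by apply: probability_le1; exact: measurableU.
have [mU2|mU2] := lerP (fine (m U)) 2^-1; first by exists U; rewrite // gt0.
exists V; rewrite // gt0//=; lra.
Qed.

(** * A random element of [K] that encodes a sign *)

Section sign.
Context (R : realType) (G : groupType) (K : topologicalGroupType) (H : set G).
Context (cK : compact [set: K]) (mK : metrizable R K) (cG : countable [set: G]).
Context (m : probability (borel K) R) (hm : normalized_haar m).
Context (A : set (borel K)) (mA : measurable A) (mA01 : 0 < fine (m A) < 1).
Let Om := powg (G * bool)%type K.
Context (M : probability (borel Om) R) (hM : normalized_haar M).

(* As s varies, pick s g w runs through the two coordinates w (g, false) and
   w (g, true); it is biased towards A for s = true and away from A for
   s = false. *)
Definition pick (s : bool) (g : G) (w : Om) : K :=
  if `[< A (w (g, false)) >] == s then w (g, false) else w (g, true).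

Let mA_coord i : measurable ([set w | A (w i)] : set (borel Om)).
Proof. exact: measurable_preimage (measurable_coord i) mA. Qed.

Let mpick s g : measurable_fun setT (pick s g : borel Om -> borel K).
Proof.
have mb : measurable_fun setT
    ((fun w => `[< A (w (g, false)) >] == s) : borel Om -> bool).
  apply: (measurable_fun_bool true); rewrite setTI.
  have mAg := mA_coord (g, false); case: s.
    rewrite (_ : _ @^-1` _ = [set w : borel Om | A (w (g, false))])//.
    by apply/seteqP; split=> w /=; rewrite eqb_id => /asboolP.
  rewrite (_ : _ @^-1` _ = ~` [set w : borel Om | A (w (g, false))]).
    exact: measurableC.
  by apply/seteqP; split=> w /=; rewrite eqbF_neg => /asboolPn.
apply: measurable_fun_ifT => //; exact: measurable_coord.
Qed.

(** For each [w] the two picks are the two coordinates over [g] in some order, so the indicators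
    have equal sums pointwise. [Q] may also depend on [w], which allows quotients by another
    pick. *)
Lemma pickVpick g (Q : Om -> K -> Prop) :
  measurable ([set w | Q w (pick true g w)] : set (borel Om)) ->
  measurable ([set w | Q w (pick false g w)] : set (borel Om)) ->
  measurable ([set w | Q w (w (g, false))] : set (borel Om)) ->
  measurable ([set w | Q w (w (g, true))] : set (borel Om)) ->
  fine (M [set w | Q w (pick true g w)]) + fine (M [set w | Q w (pick false g w)]) =
  fine (M [set w | Q w (w (g, false))]) + fine (M [set w | Q w (w (g, true))]).
Proof.
move=> m1 m2 m3 m4.
rewrite -(Rintegral_indic M m1) -(Rintegral_indic M m2).
rewrite -(Rintegral_indic M m3) -(Rintegral_indic M m4).
rewrite -!Rintegral_bmeasD; try exact: bmeas_indic.
apply: eq_Rintegral => w _.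
have inE' (B : set Om) : \1_B w = `[< B w >]%:R :> R.
  by rewrite indicE; congr (nat_of_bool _)%:R; apply/idP/asboolP; rewrite inE.
rewrite !inE' /pick/=.
by case: `[< A _ >]; rewrite /= 1?addrC.
Qed.

Lemma pick_eq s g (w w' : Om) : (forall b, w (g, b) = w' (g, b)) ->
  pick s g w = pick s g w'.
Proof. by move=> ww'; rewrite /pick !ww'. Qed.

Let mdiv (F1 F2 : Om -> K) (B : set (borel K)) : measurable B ->
  measurable_fun setT (F1 : borel Om -> borel K) ->
  measurable_fun setT (F2 : borel Om -> borel K) ->
  measurable ([set w | B (F1 w * (F2 w)^-1)%g] : set (borel Om)).
Proof.
move=> mB m1 m2.
have m12 : measurable_fun setT ((fun w => F1 w * (F2 w)^-1)%g : borel Om -> borel K).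
  by apply: (measurable_mulg cK mK m1); exact: measurable_invg m2.
exact: measurable_preimage m12 mB.
Qed.

(** [pick s g' w] reads only coordinates over [g'], so multiplying the coordinate [(g, c)] on the
    left by [k] multiplies the quotient by [k]. *)
Let coord_pick g g' s c (B : set (borel K)) : g <> g' -> measurable B ->
  M [set w | B (w (g, c) * (pick s g' w)^-1)%g] = m B.
Proof.
move=> gg' mB; pose Z (w : Om) := (w (g, c) * (pick s g' w)^-1)%g.
have mZ : measurable_fun setT (Z : borel Om -> borel K).
  apply: (measurable_mulg cK mK); first exact: measurable_coord.
  exact: measurable_invg (mpick s g').
have := noise_law cK mK hm hM (i := (g, c)) measurableT mZ.
move=> /(_ _ _ B mB); rewrite setTI probability_setT mule1; apply=> // k w.
rewrite /Z single_mulE eqxx mulgA (@pick_eq s g' _ w)// => b.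
by rewrite single_mulE; case: eqP => // -[/esym].
Qed.

Let pick_coord g g' s c (B : set (borel K)) : g <> g' -> measurable B ->
  M [set w | B (pick s g w * (w (g', c))^-1)%g] = m B.
Proof.
move=> gg' mB; rewrite -(haar_invg cK mK hm mB).
rewrite -(@coord_pick g' g s c) //; first last.
- exact: measurable_preimage_invg.
- by move=> /esym.
by congr (M _); apply/seteqP; split=> w /=; rewrite invgM invgK.
Qed.

Let Phi h B s t := fine (M [set w | B (pick s h w * (pick t 1%g w)^-1)%g]).

(** Summed over either sign, [Phi] gives twice [m B]: [pickVpick] replaces the picks by the two
    coordinates, to which [coord_pick] or [pick_coord] applies. So the deviation of [Phi] from [m B]
    is odd in each sign, i.e., a constant times the product of the signs. *)
Let PhiE B h s t : h <> 1%g -> measurable (B : set (borel K)) ->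
  Phi h B s t = fine (m B) +
    (2 * s%:R - 1) * (2 * t%:R - 1) * (Phi h B true true - fine (m B)).
Proof.
move=> h1 mB.
have Phil t' : Phi h B true t' + Phi h B false t' = fine (m B) + fine (m B).
  rewrite /Phi (@pickVpick h (fun w z => B (z * (pick t' 1%g w)^-1)%g)).
  - by rewrite !coord_pick.
  - exact: mdiv.
  - exact: mdiv.
  - by apply: mdiv => //; exact: measurable_coord.
  - by apply: mdiv => //; exact: measurable_coord.
have Phir s' : Phi h B s' true + Phi h B s' false = fine (m B) + fine (m B).
  rewrite /Phi (@pickVpick 1%g (fun w z => B (pick s' h w * z^-1)%g)).
  - by rewrite !pick_coord.
  - exact: mdiv.
  - exact: mdiv.
  - by apply: mdiv => //; exact: measurable_coord.
  - by apply: mdiv => //; exact: measurable_coord.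
have := Phil true; have := Phil false; have := Phir true; have := Phir false.
by case: s; case: t => /=; lra.
Qed.

(** With p = [fine (m A)], the pick for [false] is in [A] exactly if both coordinates are, with
    probability p^2; by [pickVpick] the probabilities for the two signs add up to 2 p. *)
Let pick_half g (b : bool) : fine (M [set w | A (pick b g w)]) =
  fine (m A) * fine (m A) + 2 * fine (m A) * (1 - fine (m A)) * b%:R.
Proof.
have MA c : M [set w | A (w (g, c))] = m A.
  have := noise_coord cK mK hm hM (i := (g, c)) measurableT mA.
  by rewrite setTI probability_setT mule1; apply.
have M0 : fine (M [set w | A (pick false g w)]) = fine (m A) * fine (m A).
  rewrite (_ : [set w | _] =
      [set w | A (w (g, false))] `&` [set w | A (w (g, true))]); last first.
    apply/seteqP; split=> w /=; rewrite /pick.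
      by case: asboolP.
    by move=> [A0 A1]; case: asboolP.
  rewrite (noise_coord cK mK hm hM)// ?MA ?fineM ?fin_num_measure//.
  by move=> w w' ww' /=; rewrite ww'//= => -[].
case: b; last by rewrite M0 mulr0 addr0.
have mpA s : measurable ([set w | A (pick s g w)] : set (borel Om)).
  exact: measurable_preimage (mpick s g) mA.
have := @pickVpick g (fun _ z => A z) (mpA true) (mpA false) (mA_coord _) (mA_coord _).
by rewrite M0 !MA /= => ?; lra.
Qed.

Context d (X : measurableType d) (mu : probability X R) (T : G -> X -> X).
Context (mpsT : is_mps mu T) (E : set X) (mE : measurable E).

Let F (y : X * borel Om) := pick `[< E y.1 >] 1%g y.2.

Let mF : measurable_fun setT (F : X * borel Om -> borel K).
Proof.
have mb : measurable_fun setT ((fun y => `[< E y.1 >]) : X * borel Om -> bool).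
  apply: (measurable_fun_bool true); rewrite setTI.
  rewrite (_ : _ @^-1` _ = fst @^-1` E).
    exact: measurable_preimage measurable_fst mE.
  by apply/seteqP; split=> y /= /asboolP.
have mp s : measurable_fun setT ((fun y => pick s 1%g y.2) : X * borel Om -> borel K).
  exact: measurableT_comp (mpick s 1%g) (@measurable_snd _ _ X (borel Om)).
have := measurable_fun_ifT mb (mp true) (mp false).
by apply: eq_measurable_fun => y _; rewrite /F; case: `[< _ >].
Qed.

Let mY : is_mps (mu \x M)%E
  (fun g (y : X * borel Om) => (T g y.1, shift g y.2 : borel Om)).
Proof. by apply: (shift_mps cK mK cG) => //; exact: countableP. Qed.

Let F_shift g (y : X * borel Om) :
  F (T g y.1, shift g y.2 : borel Om) = pick `[< E (T g y.1) >] g y.2.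
Proof. by rewrite /F/= /pick /shift/= mul1g. Qed.

Let asbool_indic (B : set X) x : \1_B x = `[< B x >]%:R :> R.
Proof. by rewrite indicE; congr (nat_of_bool _)%:R; apply/idP/asboolP; rewrite inE. Qed.

(** The hypothesis on [E] says that the sign [2 * \1_E - 1] has zero correlation along [h]. By
    [PhiE], given x, the probability that the quotient lies in [B] differs from [m B] by a constant
    times the product of the two signs, and this term integrates to 0. *)
Let F_law h : h <> 1%g -> fine (mu (T h @^-1` E `&` E)) = fine (mu E) - 4^-1 ->
  haar_distributed (mu \x M)%E (fun y : X * borel Om =>
    F (T h y.1, shift h y.2 : borel Om) * (F y)^-1)%g.
Proof.
move=> h1 EhE; apply/(haar_distributedP cK mK _ _ hm) => B mB.
have mEh : measurable (T h @^-1` E).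
  exact: measurable_preimage (mps_measurable mpsT h) mE.
pose c := Phi h B true true - fine (m B).
rewrite /product_measure1.
transitivity (\int[mu]_x (fine (m B) +
    c * ((2 * \1_(T h @^-1` E) x - 1) * (2 * \1_E x - 1)))%:E)%E.
  apply: eq_integral => x _ /=; rewrite xsectionE.
  rewrite -[LHS]fineK; last first.
    apply: (fin_num_measure M); rewrite -xsectionE; apply: measurable_xsection.
    have mFh := measurableT_comp mF (mps_measurable mY h).
    have mFF : measurable_fun setT (fun y : X * borel Om =>
        F (T h y.1, shift h y.2 : borel Om) * (F y)^-1 : borel K)%g.
      by apply: (measurable_mulg cK mK mFh); exact: measurable_invg mF.
    exact: measurable_preimage mFF mB.
  congr EFin; transitivity (Phi h B `[< E (T h x) >] `[< E x >]).
    congr (fine (M _)); apply/funext => w /=.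
    rewrite (_ : pick _ h w = F (T h x, shift h w : borel Om))//.
    exact: esym (F_shift h (x, w)).
  by rewrite PhiE// !asbool_indic /c; ring.
have bh := bmeas_indic R mEh; have bE := bmeas_indic R mE.
have bZ r f : bmeas f -> bmeas (fun y : X => r * f y).
  by move=> bf; apply: bmeasM => //; exact: bmeas_cst.
have bEhE := bmeas_indic R (measurableI _ _ mEh mE).
have cE x : fine (m B) + c * ((2 * \1_(T h @^-1` E) x - 1) * (2 * \1_E x - 1)) =
    (fine (m B) + c) + (c * 4) * \1_(T h @^-1` E `&` E) x -
    ((c * 2) * \1_(T h @^-1` E) x + (c * 2) * \1_E x).
  by rewrite indicI/=; ring.
under eq_integral do rewrite cE.
rewrite -EFin_Rintegral; last first.
  by apply: bmeasB; apply: bmeasD; try exact: bZ; exact: bmeas_cst.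
rewrite Rintegral_bmeasB; last 2 first.
- by apply: bmeasD; [exact: bmeas_cst|exact: bZ].
- by apply: bmeasD; exact: bZ.
rewrite !Rintegral_bmeasD ?Rintegral_cst1; try exact: bZ; try exact: bmeas_cst.
rewrite !Rintegral_bmeasZ// !Rintegral_indic//; last exact: measurableI.
rewrite EhE (mps_preserving mpsT h mE) -[RHS]fineK ?fin_num_measure//.
by congr EFin; rewrite -/c; field.
Qed.

(** [F] is Haar distributed by [F_law] and the hypothesis on [H]. With p = [fine (m A)], its law on
    [A] and [pick_half] give p = p^2 + 2 p (1 - p) [fine (mu E)], where p (1 - p) is nonzero. *)
Lemma sign_half : mt_vdC R K H -> ~ H 1%g ->
  (forall h, H h -> fine (mu (T h @^-1` E `&` E)) = fine (mu E) - 4^-1) ->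
  fine (mu E) = 2^-1.
Proof.
move=> mtH H1 EH.
have : haar_distributed (mu \x M)%E F.
  apply: (mtH _ _ _ _ mY F mF) => h Hh; apply: F_law; last exact: EH.
  by move=> h1; apply: H1; rewrite -h1.
move=> /(haar_distributedP cK mK _ _ hm)/(_ A mA).
rewrite /product_measure1 => mAE.
pose p := fine (m A).
have : (\int[mu]_x (p * p + 2 * p * (1 - p) * \1_E x)%:E)%E = m A.
  rewrite -mAE; apply: eq_integral => x _ /=.
  rewrite xsectionE asbool_indic -(pick_half 1%g) fineK//.
  apply: (fin_num_measure M); exact: measurable_preimage (mpick _ _) mA.
have bE := bmeas_indic R mE.
rewrite -EFin_Rintegral; last first.
  by apply: bmeasD; [exact: bmeas_cst|apply: bmeasM => //; exact: bmeas_cst].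
rewrite Rintegral_bmeasD; [|exact: bmeas_cst|by apply: bmeasM => //; exact: bmeas_cst].
rewrite Rintegral_cst1 Rintegral_bmeasZ// Rintegral_indic//.
move=> /(congr1 fine)/=; rewrite -/p => pE.
have /andP[p0 p1] := mA01; rewrite -/p in p0 p1.
have pq : p * (1 - p) != 0 by rewrite mulf_neq0 ?gt_eqF// subr_gt0.
apply: (mulfI pq); lra.
Qed.

End sign.

Lemma fine_setIC (R : realType) d (X : measurableType d) (P : probability X R)
    (D B : set X) :
  measurable B -> measurable D ->
  fine (P D) = fine (P (D `&` B)) + fine (P (D `&` ~` B)).
Proof.
move=> mB mD; have mDB : measurable (D `&` B) by exact: measurableI.
have mDC : measurable (D `&` ~` B) by apply: measurableI => //; exact: measurableC.
rewrite -fineD ?fin_num_measure// -measureU//; first by rewrite -setIUr setUv setIT.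
by rewrite setIACA setICr setI0.
Qed.

(** * Random rounding of a function to an event *)

Section rounding.
Context (R : realType) (G : groupType) (K : topologicalGroupType).
Context (cK : compact [set: K]) (mK : metrizable R K) (cG : countable [set: G]).
Context (m : probability (borel K) R) (hm : normalized_haar m).
Context (A : set (borel K)) (mA : measurable A) (mA2 : 0 < fine (m A) <= 2^-1).
Let Om := powg (G * nat)%type K.
Context (M : probability (borel Om) R) (hM : normalized_haar M).

Let p := fine (m A).

Let mAE : m A = p%:E.
Proof. by rewrite fineK// fin_num_measure. Qed.

(* The expansion of t in [0, 1] as a sum of terms p (1 - p)^n has digits
   [1/2 <= iter n rest t]; it exists because p <= 1/2. *)
Definition rest (t : R) : R := (t - (if 2^-1 <= t then p else 0)) / (1 - p).

(* The digit of t at the first n such that w (g, j + n) is in A is 1: as n has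
   probability p (1 - p)^n, this event has probability t. *)
Definition hit (g : G) (j : nat) (t : R) : set Om := [set w | exists n,
  [/\ forall k, (k < n)%N -> ~ A (w (g, (j + k)%N)), A (w (g, (j + n)%N)) &
      2^-1 <= iter n rest t]].

(** Both cases rest on p <= 1/2: if t >= 1/2 then 0 <= t - p <= 1 - p, and if t < 1/2 then t <= 1 -
    p. *)
Lemma rest01 t : 0 <= t <= 1 -> 0 <= rest t <= 1.
Proof.
move=> /andP[t0 t1]; have /andP[p0 p2] := mA2; rewrite -/p in p0 p2.
rewrite /rest divr_ge0 ?ler_pdivrMr; last 3 first.
- by lra.
- by case: ifP => ?; lra.
- by lra.
by case: ifP => /negP; lra.
Qed.

Lemma hitE g j t w : hit g j t w <->
  (A (w (g, j)) /\ 2^-1 <= t) \/ (~ A (w (g, j)) /\ hit g j.+1 (rest t) w).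
Proof.
split=> [[[|n] [nA An tn]]|[[Aj t2]|[nA [n [nA' An tn]]]]].
- by left; rewrite addn0 in An.
- right; split; first by have := nA 0%N isT; rewrite addn0.
  exists n; rewrite addSnnS -iterSr; split=> // k kn.
  by rewrite addSnnS; exact: nA.
- by exists 0%N; rewrite addn0; split.
- exists n.+1; rewrite -addSnnS iterSr; split=> // -[|k] kn; first by rewrite addn0.
  by rewrite -addSnnS; exact: nA'.
Qed.

Let mA_coord i : measurable ([set w | A (w i)] : set (borel Om)).
Proof. exact: measurable_preimage (measurable_coord i) mA. Qed.

Lemma measurable_hit g j t : measurable (hit g j t : set (borel Om)).
Proof.
rewrite (_ : hit g j t = \bigcup_n
  ((\bigcap_(k in `I_n) ~` [set w | A (w (g, (j + k)%N))]) `&`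
  [set w | A (w (g, (j + n)%N))] `&`
  (if 2^-1 <= iter n rest t then setT else set0))); last first.
  apply/seteqP; split=> w [n].
    by move=> [nA An tn]; exists n => //; split; [split|rewrite tn].
  by move=> _ [[nA An]]; case: ifP => // tn _; exists n; split.
apply: bigcupT_measurable => n; apply: measurableI; last by case: ifP.
apply: measurableI; last exact: mA_coord.
by apply: bigcap_measurableType => k _; apply: measurableC; exact: mA_coord.
Qed.

Lemma hit_free g j t (J : set (G * nat)%type) :
  (forall k, (j <= k)%N -> ~ J (g, k)) -> free_of J (hit g j t).
Proof.
move=> gJ w w' ww' [n [nA An tn]]; exists n; split=> //.
  by move=> k /nA; rewrite ww'//; apply: gJ; rewrite leq_addr.
by rewrite -ww'//; apply: gJ; rewrite leq_addr.
Qed.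

(** Induction on [n], splitting [D] by whether [w (g, j)] is in [A]: the part inside contributes
    exactly the first term of the expansion of [t], and the part outside, a fraction 1 - p of [D],
    is the same problem for [rest t] and [j.+1]. For [n] = 0 both numbers lie between 0 and the
    measure of [D]. *)
Lemma hit_bound n g j t (D : set (borel Om)) : measurable D ->
  free_of [set (g, k) | k in [set k | (j <= k)%N]] D -> 0 <= t <= 1 ->
  `|fine (M (D `&` hit g j t)) - t * fine (M D)| <= (1 - p) ^+ n * fine (M D).
Proof.
elim: n j t D => [|n IH] j t D mD fD t01.
  have mDh : measurable (D `&` hit g j t).
    by apply: measurableI => //; exact: measurable_hit.
  have h0 : 0 <= fine (M (D `&` hit g j t)) by exact: fine_ge0.
  have h1 : fine (M (D `&` hit g j t)) <= fine (M D).
    by apply: fine_le; rewrite ?fin_num_measure// le_measure ?inE//; exact: subIsetl.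
  have t1 : 0 <= t * fine (M D) <= fine (M D).
    have /andP[t0 t1] := t01; rewrite mulr_ge0//=; last by rewrite fine_ge0.
    by rewrite ler_piMl ?fine_ge0.
  by rewrite expr0 mul1r ler_norml; lra.
have /andP[p0 p2] := mA2; rewrite -/p in p0 p2.
pose Aj := [set w : borel Om | A (w (g, j))].
have mAj : measurable Aj by exact: mA_coord.
have fDj : free_of [set (g, j)] D.
  by apply: free_ofS fD => _ ->; exists j => /=.
have MAj : fine (M (D `&` Aj)) = p * fine (M D).
  by rewrite (noise_coord cK mK hm hM mD mA fDj) fineM ?fin_num_measure.
have MD : fine (M D) = p * fine (M D) + fine (M (D `&` ~` Aj)).
  by rewrite -MAj -fine_setIC.
pose D' := D `&` ~` Aj.
have mD' : measurable D' by apply: measurableI => //; exact: measurableC.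
have fD' : free_of [set (g, k) | k in [set k | (j.+1 <= k)%N]] D'.
  apply: free_ofI.
    by apply: free_ofS fD => _ [k /= jk <-]; exists k => //=; exact: ltnW.
  move=> w w' ww' /=; apply: contra_not; rewrite /Aj/= ww'//= => -[k jk [kj]].
  by rewrite kj ltnn in jk.
pose s := if 2^-1 <= t then p else 0.
have ts : t = s + (1 - p) * rest t by rewrite /rest -/s; field; lra.
have hitA : fine (M ((D `&` hit g j t) `&` Aj)) = s * fine (M D).
  rewrite /s; case: ifP => t2.
    rewrite -MAj; congr (fine (M _)); apply/seteqP; split=> w; first by case=> -[].
    by move=> [Dw Aw]; split=> //; split=> //; apply/hitE; left.
  rewrite (_ : _ `&` Aj = set0) ?measure0 ?mul0r//.
  apply/seteqP; split=> w // [[Dw /hitE[[_]|[]]]] //.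
  by rewrite t2.
have hitAC : fine (M ((D `&` hit g j t) `&` ~` Aj)) =
    fine (M (D' `&` hit g j.+1 (rest t))).
  congr (fine (M _)); apply/seteqP; split=> w.
    by move=> [[Dw /hitE[[//]|[_ hw]]] nA]; split.
  by move=> [[Dw nA] hw]; split=> //; split=> //; apply/hitE; right.
rewrite (fine_setIC M mAj); last by apply: measurableI => //; exact: measurable_hit.
rewrite hitA hitAC.
have := IH j.+1 (rest t) D' mD' fD' (rest01 t01).
have -> : fine (M D') = (1 - p) * fine (M D) by rewrite /D'; lra.
have -> : t * fine (M D) = s * fine (M D) + (1 - p) * rest t * fine (M D).
  by rewrite -mulrDl -ts.
by rewrite mulrA -exprSr; congr (`| _ | <= _); ring.
Qed.

Lemma hit_law g j t (D : set (borel Om)) : measurable D ->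
  free_of [set (g, k) | k in [set k | (j <= k)%N]] D -> 0 <= t <= 1 ->
  fine (M (D `&` hit g j t)) = t * fine (M D).
Proof.
move=> mD fD t01; have /andP[p0 p2] := mA2; rewrite -/p in p0 p2.
apply/eqP; rewrite -subr_eq0 -normr_le0.
have qc : (fun n => (1 - p) ^+ n * fine (M D)) @ \oo --> (0 : R).
  rewrite -[X in _ --> X](mul0r (fine (M D))); apply: cvgMl.
  by apply: cvg_expr; rewrite ger0_norm; lra.
by apply: (cvgr_to_ge qc); apply: nearW => n; exact: hit_bound.
Qed.

Context (H : set G) (mtH : mt_vdC R K H) (H1 : ~ H 1%g).
Context d (X : measurableType d) (mu : probability X R) (T : G -> X -> X).
Context (mpsT : is_mps mu T) (t : X -> R) (mt : measurable_fun setT t).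
Context (t01 : forall x, 0 <= t x <= 1).

Let E : set (X * borel Om) := [set y | hit 1%g 0 (t y.1) y.2].

Let measurable_rest : measurable_fun setT rest.
Proof.
apply: measurable_funM; last exact: measurable_cst.
apply: measurable_funB; first exact: measurable_id.
apply: measurable_fun_ifT; [|exact: measurable_cst|exact: measurable_cst].
by apply: measurable_fun_ler; [exact: measurable_cst|exact: measurable_id].
Qed.

Let mE : measurable E.
Proof.
have mtn n : measurable_fun setT (fun x => iter n rest (t x)).
  by elim: n => [//|n IH]; exact: measurableT_comp measurable_rest IH.
have mw i : measurable ([set y | A (y.2 i)] : set (X * borel Om)).
  exact: measurable_preimage (@measurable_snd _ _ X (borel Om)) (mA_coord i).
have mx n : measurable ([set y | 2^-1 <= iter n rest (t y.1)] : set (X * borel Om)).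
  have mxn : measurable [set x | 2^-1 <= iter n rest (t x)].
    rewrite (_ : [set x | _] =
        (fun x => iter n rest (t x)) @^-1` `[2^-1, +oo[); last first.
      by apply/seteqP; split=> x /=; rewrite in_itv/= andbT.
    by apply: measurable_preimage (mtn n) _; exact: measurable_itv.
  exact: measurable_preimage (@measurable_fst _ _ X (borel Om)) mxn.
rewrite (_ : E = \bigcup_n ((\bigcap_(k in `I_n) ~` [set y | A (y.2 (1%g, k))]) `&`
  [set y | A (y.2 (1%g, n))] `&` [set y | 2^-1 <= iter n rest (t y.1)])); last first.
  by apply/seteqP; split=> y [n];
    [move=> [nA An tn]; exists n|move=> _ [[nA An] tn]; exists n].
apply: bigcupT_measurable => n; apply: measurableI => //; apply: measurableI => //.
by apply: bigcap_measurableType => k _; exact: measurableC.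
Qed.

Let hit_lawT g x : fine (M (hit g 0 (t x))) = t x.
Proof.
have fT : free_of [set (g, k) | k in [set k | (0 <= k)%N]] (setT : set Om) by [].
by have := hit_law measurableT fT (t01 x); rewrite setTI probability_setT mulr1.
Qed.

(** Given x, [E] has probability [t x]. For h other than 1, the events [hit] for 1 and for h read
    disjoint sets of coordinates and are independent, so the correlations of [E] are those of [t],
    and [sign_half] applies to [E]. *)
Lemma rounding_half : (forall h, H h ->
    \int[mu]_x (t (T h x) * t x) = \int[mu]_x t x - 4^-1) ->
  \int[mu]_x t x = 2^-1.
Proof.
move=> tH.
have cB : countable [set: (G * bool)%type].
  by apply: countable_index => //; exact: countableP.
(* [sign_half] adds a second noise, indexed by [G * bool], to the system already extended by [M]. *)
have [M' hM'] : exists M' : probability (borel (powg (G * bool)%type K)) R,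
    normalized_haar M'.
  apply: normalized_haar_ex; first exact: powg_compact.
  by apply: (@metrizable_hausdorff R); exact: powg_metrizable cB mK.
have mY : is_mps (mu \x M)%E
    (fun g (y : X * borel Om) => (T g y.1, shift g y.2 : borel Om)).
  by apply: (shift_mps cK mK cG) => //; exact: countableP.
have bt : bmeas t.
  by split=> //; exists 1 => x; have /andP[t0 t1] := t01 x; rewrite ger0_norm.
have PE : fine ((mu \x M)%E E) = \int[mu]_x t x.
  apply: (congr1 fine (y := EFin _)).
  rewrite EFin_Rintegral// /product_measure1; apply: eq_integral => x _ /=.
  rewrite xsectionE -[RHS](congr1 EFin (hit_lawT 1%g x)) fineK//.
  by apply: (fin_num_measure M); exact: measurable_hit.
have mA01 : 0 < fine (m A) < 1 by have /andP[-> ?] := mA2; lra.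
suff : fine ((mu \x M)%E E) = 2^-1 by rewrite PE.
apply: (sign_half cK mK cG hm mA mA01 hM' mY mE mtH H1) => h Hh.
have h1 : h <> 1%g by move=> h1; apply: H1; rewrite -h1.
rewrite PE -(tH h)//; apply: (congr1 fine (y := EFin _)).
rewrite EFin_Rintegral; last first.
  by apply: bmeasM => //; exact: bmeas_comp (mps_measurable mpsT h) bt.
rewrite /product_measure1; apply: eq_integral => x _ /=.
rewrite xsectionE (_ : [set w | _] = hit 1%g 0 (t x) `&` hit h 0 (t (T h x))); last first.
  by apply/seteqP; split=> w [hw1 hw2]; split => //; move: hw1 hw2;
    rewrite /E/hit/=/shift/= mul1g.
rewrite -[LHS]fineK; last first.
  by apply: (fin_num_measure M); apply: measurableI; exact: measurable_hit.
congr EFin; rewrite hit_law//; [by rewrite hit_lawT|exact: measurable_hit|].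
by apply: hit_free => k _ [k' _ [hh _]]; exact: h1.
Qed.

End rounding.

Lemma Rintegral_prod_indic (R : realType) d d' (X : measurableType d)
    (Y : measurableType d') (mu : probability X R) (nu : probability Y R) (u : X -> R) (A : set Y) :
  bmeas u -> measurable A ->
  \int[(mu \x nu)%E]_y (u y.1 * \1_A y.2) = fine (nu A) * \int[mu]_x u x.
Proof.
move=> bu mA.
have buA : bmeas (fun y : X * Y => u y.1 * \1_A y.2).
  apply: bmeasM; first exact: bmeas_comp measurable_fst bu.
  exact: bmeas_comp measurable_snd (bmeas_indic R mA).
rewrite -Rintegral_bmeasZ// /Rintegral; congr fine.
have iuA : (mu \x nu)%E.-integrable setT (EFin \o (fun y : X * Y => u y.1 * \1_A y.2)).
  exact: bmeas_integrable buA.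
rewrite -(integral12_prod_meas1 iuA); apply: eq_integral => x _.
rewrite /fubini_F/= -EFin_Rintegral; last first.
  by apply: bmeasM; [exact: bmeas_cst|exact: bmeas_indic].
congr EFin; rewrite (Rintegral_bmeasZ nu (u x) (bmeas_indic R mA)).
by rewrite (Rintegral_indic nu mA) mulrC.
Qed.

(** * Reduction of complex functions to functions with values in [0, 1] *)

Section mt_vdC_vdC.
Context (R : realType) (G : groupType) (K : topologicalGroupType) (H : set G).
Context (cK : compact [set: K]) (mK : metrizable R K) (cG : countable [set: G]).
Context (K1 : exists k : K, k <> 1%g) (mtH : mt_vdC R K H).

Lemma mt_vdC_real d (X : measurableType d) (mu : probability X R) (T : G -> X -> X)
    (g : X -> R) : ~ H 1%g -> is_mps mu T -> bmeas g ->
  (forall h, H h -> \int[mu]_x (g (T h x) * g x) = 0) -> \int[mu]_x g x = 0.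
Proof.
move=> H1 mT bg gH; have [mg [C gC]] := bg.
have [m hm] := normalized_haar_ex R cK (metrizable_hausdorff mK).
have [A mA A2] := haar_half_set cK (metrizable_hausdorff mK) K1 hm.
have cN : countable [set: (G * nat)%type].
  by apply: countable_index => //; exact: countableP.
have [M hM] : exists M : probability (borel (powg (G * nat)%type K)) R, normalized_haar M.
  apply: normalized_haar_ex; first exact: powg_compact.
  by apply: (@metrizable_hausdorff R); exact: powg_metrizable cN mK.
(* This scaling puts c g in [-1/2, 1/2]; the summand 1 keeps the denominator positive. *)
pose c := (2 * (`|C| + 1))^-1.
have c0 : 0 < c by rewrite invr_gt0; have := normr_ge0 C; lra.
have gc x : `|c * g x| <= 2^-1.
  rewrite normrM gtr0_norm// /c invfM -mulrA ler_piMr// ?invr_ge0//.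
  rewrite mulrC ler_pdivrMr ?mul1r; last by have := normr_ge0 C; lra.
  by rewrite (le_trans (gC x))// (le_trans (ler_norm C))// lerDl.
pose t x := 2^-1 + c * g x.
have bcg : bmeas (fun x => c * g x) by apply: bmeasM => //; exact: bmeas_cst.
have bt : bmeas t by apply: bmeasD => //; exact: bmeas_cst.
have t01 x : 0 <= t x <= 1 by have := gc x; rewrite /t ler_norml; lra.
have It : \int[mu]_x t x = 2^-1 + c * \int[mu]_x g x.
  by rewrite Rintegral_bmeasD ?Rintegral_cst1 ?Rintegral_bmeasZ//; exact: bmeas_cst.
have : \int[mu]_x t x = 2^-1.
  apply: (rounding_half cK mK cG hm mA A2 hM mtH H1 mT) => //; first by have [] := bt.
  move=> h Hh; rewrite It.
  have bgT := bmeas_comp (mps_measurable mT h) bg.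
  have bcgT : bmeas (fun x => c * g (T h x)) by apply: bmeasM => //; exact: bmeas_cst.
  (* As T_h preserves [mu] and the last term has mean 0, the mean is 1/4 plus c times the mean of
     [g], that is, the mean of [t] minus 1/4. *)
  have tE x : t (T h x) * t x =
      4^-1 + (2^-1 * (c * g (T h x)) + 2^-1 * (c * g x)) +
      c ^+ 2 * (g (T h x) * g x).
    by rewrite /t; field.
  have bZ r f : bmeas f -> bmeas (fun x : X => r * f x).
    by move=> bf; apply: bmeasM => //; exact: bmeas_cst.
  under eq_Rintegral do rewrite tE.
  rewrite Rintegral_bmeasD; last 2 first.
  - by apply: bmeasD; [exact: bmeas_cst|apply: bmeasD; exact: bZ].
  - by apply: bZ; exact: bmeasM.
  rewrite Rintegral_bmeasD; [|exact: bmeas_cst|by apply: bmeasD; exact: bZ].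
  rewrite Rintegral_bmeasD; try exact: bZ.
  rewrite Rintegral_cst1 !Rintegral_bmeasZ//; last exact: bmeasM.
  by rewrite gH// (Rintegral_mps mT)//; field.
rewrite It => cI; have /eqP : c * \int[mu]_x g x = 0 by lra.
by rewrite mulf_eq0 gt_eqF//= => /eqP.
Qed.

Lemma mt_vdC_vdC : vdC R H.
Proof.
move=> d X mu T mT f mf fC fH.
have [bRe bIm] := bmeas_Re_Im mf fC.
set a := (fun x => complex.Re (f x)) in bRe; set b := (fun x => complex.Im (f x)) in bIm.
have bT h u : bmeas u -> bmeas (fun x => u (T h x)) := bmeas_comp (mps_measurable mT h).
(* The integrand is the real part of f(T_h x) times the conjugate of f(x). *)
have corr h : H h -> \int[mu]_x (a (T h x) * a x + b (T h x) * b x) = 0.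
  move=> /fH [+ _]; apply: etrans; apply: eq_Rintegral => x _.
  by rewrite /a /b; case: (f (T h x)) (f x) => [u v] [w z] /=; ring.
suff [Ia Ib] : \int[mu]_x a x = 0 /\ \int[mu]_x b x = 0 by rewrite /Cintegral Ia Ib.
(* If 1 is in [H], the mean of |f|^2 is 0, and since variances are nonnegative it bounds the sum of
   the squares of the means of [a] and [b]. *)
have [H1|H1] := pselect (H 1%g).
  have sq u : bmeas u -> (\int[mu]_x u x) ^+ 2 <= \int[mu]_x (u x * u x).
    move=> bu; set al := \int[mu]_x u x.
    have : 0 <= \int[mu]_x ((u x - al) * (u x - al)).
      by apply: Rintegral_ge0 => x _; rewrite -expr2 sqr_ge0.
    have buu := bmeasM bu bu.
    have b2 : bmeas (fun x => 2 * al * u x) by apply: bmeasM => //; exact: bmeas_cst.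
    have uE x : (u x - al) * (u x - al) = u x * u x - 2 * al * u x + al ^+ 2 by ring.
    under eq_Rintegral do rewrite uE.
    rewrite Rintegral_bmeasD; [|exact: bmeasB|exact: bmeas_cst].
    rewrite Rintegral_bmeasB// Rintegral_bmeasZ// Rintegral_cst1 -/al; nra.
  have := corr 1%g H1; under eq_Rintegral do rewrite !(mps_act1 mT).
  rewrite Rintegral_bmeasD; [|exact: bmeasM|exact: bmeasM] => ab0.
  have a2 := sq a bRe; have b2 := sq b bIm.
  by split; apply/eqP; rewrite -sqrf_eq0 eq_le sqr_ge0 andbT;
    have := sqr_ge0 (\int[mu]_x a x); have := sqr_ge0 (\int[mu]_x b x); lra.
have [m hm] := normalized_haar_ex R cK (metrizable_hausdorff mK).
have [A mA A2] := haar_half_set cK (metrizable_hausdorff mK) K1 hm.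
have mAC := measurableC mA.
pose p := fine (m A); have /andP[p0 p2] : 0 < p <= 2^-1 := A2.
have q0 : 0 < 1 - p by lra.
have mACE : fine (m (~` A)) = 1 - p.
  by have := fine_setIC m mA measurableT; rewrite !setTI probability_setT/= -/p; lra.
(* With these weights the correlation of g is the sum of those of a and b. *)
pose al := Num.sqrt p^-1; pose be := Num.sqrt (1 - p)^-1.
have alE : al * al * p = 1 by rewrite -expr2 sqr_sqrtr ?invr_ge0 ?ltW// mulVf// gt_eqF.
have beE : be * be * (1 - p) = 1.
  by rewrite -expr2 sqr_sqrtr ?invr_ge0 ?ltW// mulVf// gt_eqF.
have mY := mps_static mT m cK mK.
have bprod (u : X -> R) (B : set (borel K)) : bmeas u -> measurable B ->
    bmeas (fun y : X * borel K => u y.1 * \1_B y.2).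
  move=> bu mB; apply: bmeasM.
    exact: (bmeas_comp (@measurable_fst _ _ X (borel K)) bu).
  exact: (bmeas_comp (@measurable_snd _ _ X (borel K)) (bmeas_indic R mB)).
have bZ d' (Y : measurableType d') r (u : Y -> R) : bmeas u -> bmeas (fun x => r * u x).
  by move=> bu; apply: bmeasM => //; exact: bmeas_cst.
(* [A] and its complement are disjoint, so no mixed products of [a] and [b] appear in the
   correlations of [g]. Adding and subtracting the identities for s = 1 and s = -1 separates the two
   means. *)
have mean s : s * s = 1 ->
    al * p * \int[mu]_x a x + s * be * (1 - p) * \int[mu]_x b x = 0.
  move=> s1; pose g (y : X * borel K) :=
    al * (a y.1 * \1_A y.2) + (s * be) * (b y.1 * \1_(~` A) y.2).
  have bg : bmeas g by apply: bmeasD; apply: bZ; exact: bprod.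
  have := mt_vdC_real H1 mY bg.
  rewrite Rintegral_bmeasD; try by apply: bZ; exact: bprod.
  rewrite !Rintegral_bmeasZ; try exact: bprod.
  rewrite !Rintegral_prod_indic// mACE -/p => gI.
  rewrite -[RHS]gI; first by ring.
  move=> h Hh; rewrite /g /=.
  have gE (y : X * borel K) :
      (al * (a (T h y.1) * \1_A y.2) +
       (s * be) * (b (T h y.1) * \1_(~` A) y.2)) *
      (al * (a y.1 * \1_A y.2) + (s * be) * (b y.1 * \1_(~` A) y.2)) =
      (al * al) * ((a (T h y.1) * a y.1) * \1_A y.2) +
      (s * s * (be * be)) * ((b (T h y.1) * b y.1) * \1_(~` A) y.2).
    by rewrite !indicE in_setC; case: (y.2 \in A) => /=; ring.
  under eq_Rintegral do rewrite gE.
  have baa : bmeas (fun x => a (T h x) * a x) by apply: bmeasM => //; exact: bT.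
  have bbb : bmeas (fun x => b (T h x) * b x) by apply: bmeasM => //; exact: bT.
  rewrite Rintegral_bmeasD; [|exact: bZ (bprod _ _ baa mA)|exact: bZ (bprod _ _ bbb mAC)].
  rewrite (Rintegral_bmeasZ _ _ (bprod _ _ baa mA)).
  rewrite (Rintegral_bmeasZ _ _ (bprod _ _ bbb mAC)).
  rewrite (Rintegral_prod_indic mu m baa mA) (Rintegral_prod_indic mu m bbb mAC).
  by rewrite mACE -/p s1 mul1r !mulrA alE beE !mul1r -Rintegral_bmeasD// corr.
have al0 : al != 0.
  by apply: contraTneq (ltr01 : 0 < 1 :> R) => z; rewrite -alE z !mul0r ltxx.
have be0 : be != 0.
  by apply: contraTneq (ltr01 : 0 < 1 :> R) => z; rewrite -beE z !mul0r ltxx.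
have M1 := mean 1 (mulr1 1).
have M2 : al * p * \int[mu]_x a x + -1 * be * (1 - p) * \int[mu]_x b x = 0.
  by apply: mean; rewrite mulrNN mulr1.
have Ea : al * p * \int[mu]_x a x = 0 by move: M1 M2; rewrite mulN1r; lra.
have Eb : be * (1 - p) * \int[mu]_x b x = 0 by move: M1 M2; rewrite mul1r mulN1r; lra.
split; apply/eqP.
  by move/eqP : Ea; rewrite !mulf_eq0 (negbTE al0) (gt_eqF p0).
by move/eqP : Eb; rewrite !mulf_eq0 (negbTE be0) (gt_eqF q0).
Qed.

End mt_vdC_vdC.

Theorem theorem4p6 (R : realType) (G : groupType) (K : topologicalGroupType)
    (H : set G)
    (Gcountable : countable [set: G]) (Ginfinite : infinite_set [set: G])
    (Kcompact : compact [set: K]) (Kmetrizable : metrizable R K)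
    (Knontrivial : exists k : K, k <> 1%g) :
  vdC R H <-> mt_vdC R K H.
Proof.
split; first exact: vdC_mt_vdC.
exact: mt_vdC_vdC.
Qed.
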